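(* Let $d\in\mathbb{N}$, $\lambda>0$ and $\beta>\max(d/2,1)$. Then the zero cell $Z_{d,\lambda,\beta}$ has the same distribution as the convex dual $P_{d,\alpha,\beta}^\circ$ of the beta$^*$ set $P_{d,\alpha,\beta}$ with $\alpha=\lambda/(\tilde c_{d,\beta}\,\omega_d)$.
   Context: $\overline{\mathbb{B}}^d$ is the closed unit ball in $\mathbb{R}^d$, $\mathbb{S}^{d-1}$ the unit sphere, $\omega_d=2\pi^{d/2}/\Gamma(d/2)$. Zero cell (in the Klein model of hyperbolic space on the open unit ball): let $r_1<r_2<\dots$ be the points of a Poisson process on $(0,1)$ with Lebesgue intensity $f(r)=\lambda\,\frac{r^{2\beta-d-1}}{(1-r^2)^\beta}$, and, independently, let $u_1,u_2,\dots$ be i.i.d. uniformly distributed on $\mathbb{S}^{d-1}$. The hyperplanes of the tessellation are $\{x:\|x\|<1,\ \langle x,u_n\rangle=r_n\}$, $n\in\mathbb{N}$, and the zero cell is $$Z_{d,\lambda,\beta}=\{x\in\overline{\mathbb{B}}^d:\langle x,u_n\rangle\le r_n\text{ for all }n\in\mathbb{N}\}.$$ For $\alpha>0$, $\beta>d/2$, the beta$^*$ set $P_{d,\alpha,\beta}$ is the closed convex hull of the atoms of a Poisson process on $\mathbb{R}^d\setminus\overline{\mathbb{B}}^d$ with Lebesgue intensity $\alpha\,\tilde c_{d,\beta}(\|x\|^2-1)^{-\beta}$, where $\tilde c_{d,\beta}=\frac{\Gamma(\beta)}{\pi^{d/2}\Gamma(\beta-\frac d2)}$. The convex dual of $K\subset\mathbb{R}^d$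 is $K^\circ=\{x\in\mathbb{R}^d:\langle x,y\rangle\le1\text{ for all }y\in K\}$. Equality in distribution is that of random closed convex sets. *)

(* Defs.v *)
From HB Require Import structures.
From mathcomp Require Import all_boot all_order all_algebra.
From mathcomp Require Import all_classical all_reals all_analysis.
(* not exported by all_analysis; it makes [\bar R] a measurable space *)
From mathcomp Require Import measurable_realfun.

Set Implicit Arguments.
Unset Strict Implicit.
Unset Printing Implicit Defensive.
Import Order.TTheory GRing.Theory Num.Theory.
Import numFieldTopology.Exports numFieldNormedType.Exports.

Local Open Scope classical_set_scope.
Local Open Scope ring_scope.

Definition measure_rV_display : measure_display -> measure_display.
Proof. exact. Qed.

(* R^n is ['rV[R]_n]. Its sigma-algebra is generated by the coordinates, as the
   library does for [n.-tuple T]; it is the Borel sigma-algebra. *)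
Section measurable_rV.
Context {R : realType} (n : nat).

Definition rV_coord (i : 'I_n) (x : 'rV[R]_n) : measurableTypeR R := x 0 i.

Let rV_set0 : g_sigma_preimage rV_coord set0.
Proof. exact: sigma_algebra0. Qed.

Let rV_setC A : g_sigma_preimage rV_coord A -> g_sigma_preimage rV_coord (~` A).
Proof. exact: sigma_algebraC. Qed.

Let rV_bigcup (F : (set 'rV[R]_n)^nat) :
  (forall i, g_sigma_preimage rV_coord (F i)) ->
  g_sigma_preimage rV_coord (\bigcup_i (F i)).
Proof. exact: sigma_algebra_bigcup. Qed.

HB.instance Definition _ := @isMeasurable.Build
  (measure_rV_display default_measure_display)
  'rV[R]_n (g_sigma_preimage rV_coord) rV_set0 rV_setC rV_bigcup.

End measurable_rV.

Section measurable_rV_lemmas.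
Context {R : realType}.

Lemma measurable_rV_coord n (i : 'I_n) :
  measurable_fun [set: 'rV[R]_n] (rV_coord i).
Proof.
move=> _ Y mY; rewrite setTI; apply: sub_sigma_algebra => /=.
rewrite -bigcup_seq/=; exists i => /=; first by rewrite mem_index_enum.
by exists Y => //; rewrite setTI.
Qed.

Lemma measurable_fun_rV d (T : measurableType d) n (f : T -> 'rV[R]_n) :
  (forall i, measurable_fun [set: T] (rV_coord i \o f)) ->
  measurable_fun [set: T] f.
Proof.
move=> mf _ A mA; rewrite setTI.
pose G := [set B : set 'rV[R]_n | measurable (f @^-1` B)].
suff: (measurable : set (set 'rV[R]_n)) `<=` G by apply.
apply: smallest_sub.
  split => [|B GB|F GF]; rewrite /G/=.
  - by rewrite preimage_set0.
  - by rewrite setTD -preimage_setC; exact: measurableC.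
  - by rewrite preimage_bigcup; apply: bigcup_measurable => k _; exact: GF.
rewrite -bigcup_seq => B [i _ [C mC <-]]; rewrite /G/= setTI.
by have := mf i measurableT C mC; rewrite setTI.
Qed.

Definition rV_cons n (p : measurableTypeR R * 'rV[R]_n) : 'rV[R]_n.+1 :=
  \row_(i < n.+1) if unlift ord0 i is Some j then p.2 0 j else p.1.

Definition rV_uncons n (x : 'rV[R]_n.+1) : measurableTypeR R * 'rV[R]_n :=
  (x 0 ord0, \row_(j < n) x 0 (lift ord0 j)).

Lemma rV_consK n : cancel (@rV_cons n) (@rV_uncons n).
Proof.
move=> [a v]; rewrite /rV_uncons mxE unlift_none/=; congr pair.
by apply/rowP => j; rewrite !mxE liftK.
Qed.

Lemma measurable_rV_cons n : measurable_fun setT (@rV_cons n).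
Proof.
apply: measurable_fun_rV => i; have [j ij|i0] := unliftP ord0 i.
  rewrite (_ : _ \o _ = rV_coord j \o snd).
    exact: measurableT_comp (@measurable_rV_coord _ j) measurable_snd.
  by apply/funext => p; rewrite /rV_coord/= mxE ij liftK.
rewrite (_ : _ \o _ = fst); first exact: measurable_fst.
by apply/funext => p; rewrite /rV_coord/= mxE i0 unlift_none.
Qed.

Lemma measurable_rV_uncons n : measurable_fun setT (@rV_uncons n).
Proof.
apply: measurable_fun_pair.
  exact: (@measurable_rV_coord n.+1 ord0).
apply: measurable_fun_rV => i.
rewrite (_ : _ \o _ = rV_coord (lift ord0 i)).
  exact: measurable_rV_coord.
by apply/funext => x; rewrite /rV_coord/= mxE.
Qed.

HB.instance Definition _ n := isMeasurableFun.Build _ _ _ _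
  (@rV_cons n) (@measurable_rV_cons n).

Section rV_cons_measure.
Local Open Scope ereal_scope.
Context n (m : {sigma_finite_measure set 'rV[R]_n -> \bar R}).

Definition cons_measure : set 'rV[R]_n.+1 -> \bar R :=
  pushforward ((@lebesgue_measure R) \x m) (@rV_cons n).

Let cons_measure0 : cons_measure set0 = 0.
Proof. exact: measure0. Qed.

Let cons_measure_ge0 A : 0 <= cons_measure A.
Proof. exact: measure_ge0. Qed.

Let cons_measure_sigma_additive : semi_sigma_additive cons_measure.
Proof. exact: measure_semi_sigma_additive. Qed.

HB.instance Definition _ := isMeasure.Build _ _ _ cons_measure
  cons_measure0 cons_measure_ge0 cons_measure_sigma_additive.

Let cons_measure_sigma_finite : sigma_finite setT cons_measure.
Proof.
have /sigma_finiteP[F [TF ndF Foo]] := sigma_finiteT (@lebesgue_measure R).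
have /sigma_finiteP[G [TG ndG Goo]] := sigma_finiteT m.
exists (fun k => @rV_uncons n @^-1` (F k `*` G k)).
  rewrite -preimage_bigcup -[LHS](preimage_setT (@rV_uncons n)).
  congr (_ @^-1` _); apply/esym/seteqP; split=> // -[x v] _.
  have [i _ Fi] : (\bigcup_i F i) x by rewrite -TF.
  have [j _ Gj] : (\bigcup_i G i) v by rewrite -TG.
  exists (maxn i j) => //; split => /=.
    by move: x Fi; exact/subsetPset/ndF/leq_maxl.
  by move: v Gj; exact/subsetPset/ndG/leq_maxr.
move=> k; have [mF Fk] := Foo k; have [mG Gk] := Goo k; split.
  rewrite -[X in measurable X]setTI.
  by apply: measurable_rV_uncons => //; exact: measurableX.
rewrite /cons_measure /pushforward -comp_preimage.
rewrite (_ : _ \o _ = id) ?preimage_id; last first.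
  by apply/funext => p /=; rewrite rV_consK.
by rewrite product_measure1E// lte_mul_pinfty// ge0_fin_numE.
Qed.

HB.instance Definition _ := Measure_isSigmaFinite.Build _ _ _ cons_measure
  cons_measure_sigma_finite.

End rV_cons_measure.

Fixpoint lebesgue_rV n : {sigma_finite_measure set 'rV[R]_n -> \bar R} :=
  if n is n'.+1 then cons_measure (lebesgue_rV n') else \d_(0 : 'rV[R]_0).

End measurable_rV_lemmas.
Arguments lebesgue_rV {R} n.

Section euclidean.
Context {R : realType} {d : nat}.
Implicit Types (x y : 'rV[R]_d) (A K : set 'rV[R]_d).

Definition dot x y : R := \sum_(i < d) x 0 i * y 0 i.

(* The library norm [`|x|] on ['rV[R]_d] is the sup norm, hence this one. *)
Definition enorm x : R := Num.sqrt (dot x x).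

Definition closed_ball1 : set 'rV[R]_d := [set x | enorm x <= 1].

Definition convex_dual K : set 'rV[R]_d :=
  [set x | forall y, K y -> dot x y <= 1].

Definition closed_convex_hull A : set 'rV[R]_d :=
  smallest [set K : set 'rV[R]_d | closed K /\ convex_set K] A.

(* The part [{t a | 0 < t <= 1, a in A, enorm a = 1}] of the cone over [A]. *)
Definition spherical_cone A : set 'rV[R]_d :=
  [set x | [/\ x != 0, enorm x <= 1 & A ((enorm x)^-1 *: x)]].

(* Normalised spherical Lebesgue measure on the unit sphere: the surface measure
   of a Borel set [A] of the sphere is [d * lebesgue_rV d (spherical_cone A)]. *)
Definition uniform_sphere A : \bar R :=
  (fine (lebesgue_rV d (spherical_cone A)) /
   fine (lebesgue_rV d closed_ball1))%:E.

End euclidean.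

Section constants.
Context {R : realType}.

Definition Gamma (x : R) : R :=
  \int[lebesgue_measure]_(t in `]0, +oo[) (t `^ (x - 1) * expR (- t)).

Definition omega (d : nat) : R :=
  2 * pi `^ (d%:R / 2) / Gamma (d%:R / 2).

Definition ctilde (d : nat) (beta : R) : R :=
  Gamma beta / (pi `^ (d%:R / 2) * Gamma (beta - d%:R / 2)).

End constants.

Section independence.
Local Open Scope ereal_scope.
Context {dO} {Omega : measurableType dO} {R : realType}.
Variable P : probability Omega R.

Definition mutually_independent {dT} {T : measurableType dT} {I : eqType}
    (X : I -> Omega -> T) : Prop :=
  forall (s : seq I) (B : I -> set T), uniq s ->
    (forall i, measurable (B i)) ->
    P (\bigcap_(i in [set` s]) X i @^-1` B i) =
    \prod_(i <- s) P (X i @^-1` B i).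

Definition sigma_of_sequence {dT} {T : measurableType dT}
    (X : nat -> Omega -> T) : set (set Omega) :=
  <<s \bigcup_n preimage_set_system setT (X n) measurable >>.

Definition independent_sequences {dS dT} {S : measurableType dS}
    {T : measurableType dT} (X : nat -> Omega -> S) (Y : nat -> Omega -> T) :
    Prop :=
  forall A B, sigma_of_sequence X A -> sigma_of_sequence Y B ->
    P (A `&` B) = P A * P B.

End independence.

Section poisson_process.
Local Open Scope ereal_scope.
Context {dT} {T : measurableType dT} {R : realType}.

(* A finite or countable sum of Dirac measures, [D] indexing the points. *)
Definition is_counting_measure (m : set T -> \bar R) : Prop :=
  exists (D : set nat) (x : nat -> T),
    forall A, measurable A -> m A = counting (D `&` x @^-1` A).

Definition atoms (m : set T -> \bar R) : set T := [set x | 0 < m [set x]].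

Context {dO} {Omega : measurableType dO}.

(* [mu] is the intensity measure. A process on a subset [D] of [T] is seen as a
   process on [T] whose intensity measure vanishes outside [D]. *)
Record is_poisson_process (P : probability Omega R) (mu : set T -> \bar R)
    (eta : Omega -> {measure set T -> \bar R}) : Prop := IsPoissonProcess {
  poisson_process_counting : forall w, is_counting_measure (eta w) ;
  poisson_process_measurable : forall B, measurable B ->
    measurable_fun setT (fun w => eta w B) ;
  (* [poisson_pmf 0] is not a probability mass function in the library, hence
     [poisson_prob], whose second argument is a dummy *)
  poisson_process_law : forall B k, measurable B -> mu B < +oo ->
    P [set w | eta w B = k%:R%:E] = poisson_prob (fine (mu B)) 0%N [set k] ;
  poisson_process_law_infinite : forall B, measurable B -> mu B = +oo ->
    P [set w | eta w B = +oo] = 1 ;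
  poisson_process_independent : forall n (B : 'I_n -> set T),
    (forall i, measurable (B i)) -> trivIset setT B ->
    mutually_independent P (fun i w => eta w (B i)) }.

End poisson_process.

Section random_closed_convex_set.
Context {R : realType} {d : nat}.

(* On closed sets, the events "[F] hits [K]" with [K] compact generate the Borel
   sigma-algebra of the Fell topology. *)
Definition hitting_sigma_algebra : set (set (set 'rV[R]_d)) :=
  <<s [set [set F : set 'rV[R]_d | F `&` K !=set0] | K in compact] >>.

Definition random_closed_convex_set {dO} {Omega : measurableType dO}
    (X : Omega -> set 'rV[R]_d) : Prop :=
  (forall w, closed (X w) /\ convex_set (X w)) /\
  (forall A, hitting_sigma_algebra A -> measurable (X @^-1` A)).

Definition same_distribution {d1 d2} {Omega1 : measurableType d1}
    {Omega2 : measurableType d2} (P1 : probability Omega1 R)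
    (P2 : probability Omega2 R) (X1 : Omega1 -> set 'rV[R]_d)
    (X2 : Omega2 -> set 'rV[R]_d) : Prop :=
  [/\ random_closed_convex_set X1, random_closed_convex_set X2 &
      forall A, hitting_sigma_algebra A -> P1 (X1 @^-1` A) = P2 (X2 @^-1` A)].

End random_closed_convex_set.

Section zero_cell.
Context {R : realType}.

Definition zero_cell_intensity (d : nat) (lambda beta : R)
    (B : set R) : \bar R :=
  \int[lebesgue_measure]_(t in B `&` `]0, 1[)
    (lambda * (t `^ (2 * beta - d%:R - 1) / (1 - t ^+ 2) `^ beta))%:E.

Definition zero_cell {d : nat} (r : nat -> R) (u : nat -> 'rV[R]_d) :
    set 'rV[R]_d :=
  [set x | closed_ball1 x /\ forall n, dot x (u n) <= r n].

(* That the points [r n] are in ]0, 1[ almost surely follows from the choice of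
   the intensity. *)
Record zero_cell_sequences {dO} {Omega : measurableType dO} {d : nat}
    (P : probability Omega R) (lambda beta : R)
    (r : nat -> {RV P >-> R})
    (u : nat -> {RV P >-> 'rV[R]_d}) : Prop := ZeroCellSequences {
  zero_cell_increasing : {ae P, forall w, forall n, r n w < r n.+1 w} ;
  zero_cell_poisson : is_poisson_process P (zero_cell_intensity d lambda beta)
    (fun w => mseries (fun n => \d_(r n w)) 0) ;
  zero_cell_uniform : forall n A, measurable A ->
    distribution P (u n) A = uniform_sphere A ;
  zero_cell_iid : mutually_independent P u ;
  zero_cell_independent : independent_sequences P r u }.

Definition beta_star_intensity (d : nat) (alpha beta : R)
    (B : set 'rV[R]_d) : \bar R :=
  \int[lebesgue_rV d]_(x in B `\` closed_ball1)
    (alpha * ctilde d beta * (enorm x ^+ 2 - 1) `^ (- beta))%:E.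

Definition beta_star_set {d : nat} (m : set 'rV[R]_d -> \bar R) :
    set 'rV[R]_d :=
  closed_convex_hull (atoms m).

End zero_cell.

(* Main.v *)
From HB Require Import structures.
Require Import Defs.
From mathcomp Require Import all_boot all_order all_algebra.
From mathcomp Require Import all_classical all_reals all_analysis.
From mathcomp Require Import measurable_realfun.
From mathcomp Require Import ring lra.

Set Implicit Arguments.
Unset Strict Implicit.
Unset Printing Implicit Defensive.
Import Order.TTheory GRing.Theory Num.Theory.
Import numFieldTopology.Exports numFieldNormedType.Exports.

Local Open Scope classical_set_scope.
Local Open Scope ring_scope.

(* A set S of pairs (t, v) cuts out {x | <x, v> <= t for all (t, v) in S}.
   The zero cell is cut out of the ball by the pairs (r_n, u_n), and the dual of
   the beta* set by the pairs (1/|y|, y/|y|), y ranging over the atoms.  By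
   compactness, whether such a set meets a compact K depends only on which
   rational boxes of (t, v)-space meet S, so by the pi-lambda theorem the two laws
   agree as soon as the probabilities that S misses a finite union of boxes do.

   Both are void probabilities exp(-mu(boxes)).  For the atoms this is the
   definition of a Poisson process.  For (r_n, u_n), cut (0, 1) into finitely many
   cells on which the forbidden set of directions is constant: conditionally on
   the numbers N_j of radii in the cells, no forbidden direction occurs with
   probability prod_j (1 - sigma(A_j)) ^ N_j, where the N_j are independent Poisson
   variables.  The intensities agree by integration in polar coordinates; the
   constant omega_d is d times the volume of the ball, which follows from the
   Gaussian integral.  Almost surely every open cap contains some u_n, and
   r_n < 1, so that the (r_n, u_n) alone already cut out a subset of the ball. *)

(** * Measures with a density *)

(** No mapping or marking theorem for Poisson processes is proved: the two families of pairs are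
    compared only through the probability that a finite union of boxes is avoided. The total
    intensity is infinite, because (1 - r^2)^(-beta) is not integrable at 1 for beta > 1, whereas
    the Poisson weights are available only for finite means. Hence the radii are confined to windows
    of finite intensity, and continuity from above then reaches ]0, 1[. Polar coordinates are
    obtained without surface measure: by homogeneity of Lebesgue measure, the part of a cone within
    radius s has mass s^d kappa; these masses determine the image measure on the half-line, and
    differentiation gives its density. *)

Section density.
Local Open Scope ereal_scope.
Context d (T : measurableType d) (R : realType).
Variables (mu nu : {measure set T -> \bar R}) (D : set T) (mD : measurable D).
Variable g : T -> R.
Hypotheses (g0 : forall x, (0 <= g x)%R) (mg : measurable_fun setT g).
Hypothesis nuE : forall A, measurable A -> A `<=` D ->
  nu A = \int[mu]_(x in A) (g x)%:E.

Import HBNNSimple.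

Let density_indic E : measurable E ->
  \int[nu]_(x in D) (\1_E x)%:E = \int[mu]_(x in D) ((\1_E x)%:E * (g x)%:E).
Proof.
move=> mE; rewrite integral_indic// nuE//; last exact: measurableI.
rewrite setIC integral_mkcondr; apply: eq_integral => x _.
by rewrite epatch_indic/= muleC.
Qed.

Let density_nnsfun (h : {nnsfun T >-> R}) :
  \int[nu]_(x in D) (h x)%:E = \int[mu]_(x in D) ((h x)%:E * (g x)%:E).
Proof.
under [LHS]eq_integral do rewrite fimfunE -fsumEFin//.
rewrite [LHS]ge0_integral_fsum//; last 2 first.
  - by move=> r; exact/measurable_EFinP/measurableT_comp.
  - by move=> n x _; rewrite EFinM nnfun_muleindic_ge0.
under [RHS]eq_integral.
  move=> x xD; rewrite fimfunE -fsumEFin// ge0_mule_fsuml; last first.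
    by move=> r; rewrite EFinM nnfun_muleindic_ge0.
  over.
rewrite [RHS]ge0_integral_fsum//; last 2 first.
  - move=> r; apply: emeasurable_funM; last exact/measurable_EFinP/measurable_funTS.
    by apply/measurable_EFinP; do 2 apply/measurableT_comp => //.
  - by move=> n x _; apply: mule_ge0; rewrite ?lee_fin//
      -lee_fin EFinM nnfun_muleindic_ge0.
apply: eq_fsbigr => r _; rewrite integralZl_indic_nnsfun//.
have [r0|r0] := ltP r 0%R.
  rewrite preimage_nnfun0// integral_indic// set0I measure0 mule0 integral0_eq//.
  by move=> x _; rewrite indic0 mulr0 mul0e.
rewrite density_indic// -ge0_integralZl//.
- by apply: eq_integral => x _; rewrite EFinM muleA.
- apply: emeasurable_funM; last exact/measurable_EFinP/measurable_funTS.
  by apply/measurable_EFinP; exact: measurable_funTS.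
- by move=> x _; rewrite mule_ge0// lee_fin.
Qed.

(** The standard induction from indicators over simple functions to monotone limits. The density is
    known only for subsets of [D], so each integral stays restricted to [D]. *)
Lemma ge0_integral_density (f : T -> \bar R) :
  measurable_fun D f -> (forall x, D x -> 0 <= f x) ->
  \int[nu]_(x in D) f x = \int[mu]_(x in D) (f x * (g x)%:E).
Proof.
move=> mf f0; pose f_ := nnsfun_approx mD mf.
transitivity (limn (fun n => \int[nu]_(x in D) (f_ n x)%:E)).
  rewrite -monotone_convergence//=.
  - apply: eq_integral => x /[!inE] xD; apply/esym/cvg_lim => //=.
    exact: cvg_nnsfun_approx.
  - by move=> n; apply: measurableT_comp => //; exact: measurable_funTS.
  - by move=> n x _; rewrite lee_fin.
  - by move=> x _ a b ab; rewrite lee_fin//; exact/lefP/nd_nnsfun_approx.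
rewrite (_ : \int[mu]_(x in D) _ =
    limn (fun n => \int[mu]_(x in D) ((f_ n x)%:E * (g x)%:E))); last first.
  rewrite -monotone_convergence//=.
  - apply: eq_integral => x /[!inE] xD; apply/esym/cvg_lim => //=.
    by apply: cvgeZr => //; exact: cvg_nnsfun_approx.
  - move=> n; apply: emeasurable_funM; last exact/measurable_EFinP/measurable_funTS.
    exact/measurable_EFinP/measurable_funTS.
  - by move=> n x _; rewrite mule_ge0 ?lee_fin.
  - move=> x _ a b ab; rewrite lee_wpmul2r ?lee_fin//.
    exact/lefP/nd_nnsfun_approx.
by congr (limn _); apply/funext => n; exact: density_nnsfun.
Qed.

End density.

Definition image_measure d d' (T1 : measurableType d) (T2 : measurableType d')
    (R : realType) (m : {measure set T1 -> \bar R}) (f : T1 -> T2)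
    (mf : measurable_fun [set: T1] f) : {measure set T2 -> \bar R} :=
  measure_function_pushforward__canonical__measure_function_Measure m mf.

Section density_measure.
Local Open Scope ereal_scope.
Context d (T : measurableType d) (R : realType).
Variables (mu : {measure set T -> \bar R}) (g : T -> R).
Hypotheses (g0 : forall x, (0 <= g x)%R) (mg : measurable_fun setT g).

(** Nonnegativity and measurability of [g] are carried as arguments so that the measure instance
    below can be inferred from the term itself. *)
Definition density_measure of (forall x, 0 <= g x)%R & measurable_fun setT g :=
  fun A => \int[mu]_(x in A) (g x)%:E.

Local Notation nu := (density_measure g0 mg).

Let nu0 : nu set0 = 0.
Proof. exact: integral_set0. Qed.

Let nu_ge0 A : 0 <= nu A.
Proof. by apply: integral_ge0 => x _; rewrite lee_fin. Qed.

Let nu_sigma_additive : semi_sigma_additive nu.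
Proof.
move=> F mF tF mUF; rewrite /density_measure ge0_integral_bigcup//=.
- apply: is_cvg_ereal_nneg_natsum => n _.
  by apply: integral_ge0 => x _; rewrite lee_fin.
- exact/measurable_EFinP/measurable_funTS.
- by move=> x _; rewrite lee_fin.
Qed.

HB.instance Definition _ := isMeasure.Build _ _ _ nu
  nu0 nu_ge0 nu_sigma_additive.

End density_measure.

(** * Densities on the positive half-line *)

Section density_on_positive_reals.
Local Open Scope ereal_scope.
Context (R : realType).
Variables (nu : {measure set (measurableTypeR R) -> \bar R}) (g : R -> R).
Hypotheses (g0 : forall x, (0 <= g x)%R) (mg : measurable_fun setT g).
Hypothesis nu_itv : forall a b : R, (0 < a)%R -> (a < b)%R ->
  nu `]a, b]%classic = \int[lebesgue_measure]_(x in `]a, b]) (g x)%:E /\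
  nu `]a, b]%classic < +oo.

Let window (k : nat) : set (measurableTypeR R) := `](k.+1%:R^-1)%R,
  (k.+2%:R)%R]%classic.

Let mwindow k : measurable (window k).
Proof. exact: measurable_itv. Qed.

Let window_lt k : (k.+1%:R^-1 < k.+2%:R :> R)%R.
Proof. by rewrite (@le_lt_trans _ _ 1%R) ?invf_le1 ?ltr1n// ler1n. Qed.

(** Within a window [nu] is finite, so agreement on the pi-system of half-open intervals extends to
    all Borel sets. *)
Let density_window k (A : set (measurableTypeR R)) : measurable A ->
  nu (A `&` window k) = density_measure lebesgue_measure g0 mg (A `&` window k).
Proof.
move=> mA.
have HS B : ocitv B -> nu (B `&` window k) =
    density_measure lebesgue_measure g0 mg (B `&` window k).
  move=> oB; have : ocitv (B `&` window k) by apply: ocitvI => //; exact: is_ocitv.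
  case/ocitvP => [->|[[a b]/= ab BE]]; first by rewrite !measure0.
  rewrite BE /density_measure; apply: (nu_itv _ ab).1.
  have ak : (B `&` window k) ((a + b) / 2)%R.
    by rewrite BE /= in_itv/= midf_lt// midf_le// ltW.
  have sub : `]a, b] `<=` window k by rewrite -BE; exact: subIsetr.
  (* An interval contained in the window has [0 < a]: otherwise [c], the minimum of [b] and the left
     endpoint of the window, would belong to the interval but not to the window, which is open on
     the left. *)
  rewrite ltNge; apply/negP => a0.
  have b0 : (0 < b)%R.
    have /sub : `]a, b]%classic b by rewrite /= in_itv/= ab lexx.
    by rewrite /window/= in_itv/= => /andP[+ _]; apply: lt_trans; rewrite invr_gt0.
  pose c := Num.min b (k.+1%:R^-1)%R.
  have /sub : `]a, b]%classic c.
    rewrite /= in_itv/= ge_min lexx andbT lt_min ab/=.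
    by rewrite (le_lt_trans a0)// invr_gt0.
  by rewrite /window/= in_itv/= lt_min ltxx andbF.
pose m1 := mrestr nu (mwindow k).
pose m2 := mrestr (density_measure lebesgue_measure g0 mg) (mwindow k).
rewrite -[LHS]/(m1 A) -[RHS]/(m2 A).
refine (@measure_unique _ R (measurableTypeR R) (@ocitv R) (fun n => `](- n%:R)%R,
  (n%:R)%R]%classic) _ _ _ _ m1 m2 _ _ A mA) => //.
- by move=> X Y; exact: ocitvI.
- by move=> n; exact: is_ocitv.
- apply/seteqP; split => // x _; exists (Num.bound `|x|) => //=.
  have xb := archi_boundP (normr_ge0 x).
  move: xb; rewrite ltr_norml in_itv/= => /andP[-> /ltW ->] //.
- move=> n; rewrite /m1/= /mrestr.
  apply: (@le_lt_trans _ _ (nu (window k))).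
    by apply: le_measure; rewrite ?inE; [exact: measurableI|exact: mwindow|exact:
      subIsetr].
  by apply: (nu_itv _ _).2; rewrite ?invr_gt0.
Qed.

(** The mass of [nu] may be infinite near 0 or at infinity, as for the image of Lebesgue measure
    under y -> 1/|y|. The equality is therefore proved in the windows and passed to their increasing
    union. *)
Lemma density_positive_reals (A : set (measurableTypeR R)) : measurable A ->
  A `<=` `]0%R, +oo[ -> nu A = \int[lebesgue_measure]_(x in A) (g x)%:E.
Proof.
move=> mA A0; rewrite -[RHS]/(density_measure lebesgue_measure g0 mg A).
have AE : A = \bigcup_k (A `&` window k).
  apply/seteqP; split => [x Ax|x [k _ []]//].
  have x0 : (0 < x)%R by have := A0 _ Ax; rewrite /= in_itv/= andbT.
  pose k := maxn (Num.bound x) (Num.bound x^-1).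
  exists k => //; split => //; rewrite /window /= in_itv/=; apply/andP; split.
    rewrite -[ltRHS]invrK ltf_pV2 ?posrE ?invr_gt0//.
    rewrite (lt_le_trans (archi_boundP _)) ?invr_ge0 ?(ltW x0)//.
    by rewrite ler_nat ltnW// ltnS leq_maxr.
  rewrite ltW// (lt_le_trans (archi_boundP (ltW x0)))//.
  by rewrite ler_nat -addn2 (leq_trans (leq_maxl _ (Num.bound x^-1)))// leq_addr.
have ndW : nondecreasing_seq (fun k => A `&` window k).
  move=> m n mn; apply/subsetPset; apply: setIS => x.
  rewrite /window/= !in_itv/= => /andP[mx xm]; apply/andP; split.
    by rewrite (le_lt_trans _ mx)// lef_pV2 ?posrE// ler_nat.
  by rewrite (le_trans xm)// ler_nat.
have mW k : measurable (A `&` window k) by apply: measurableI.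
have mU : measurable (\bigcup_k (A `&` window k)) by exact: bigcupT_measurable.
have nuA := nondecreasing_cvg_mu mW mU ndW (mu := nu).
have := nondecreasing_cvg_mu mW mU ndW (mu := density_measure lebesgue_measure g0 mg).
rewrite (_ : _ \o _ = nu \o (fun k => A `&` window k)); last first.
  by apply/funext => k /=; rewrite density_window.
rewrite -AE in nuA *; exact: cvg_unique.
Qed.

End density_on_positive_reals.

(** * Scaling of Lebesgue measure *)

Section scaling.
Local Open Scope ereal_scope.
Context {R : realType}.
Implicit Types s : R.

Lemma measurable_rV_scale n s : measurable_fun setT (fun x : 'rV[R]_n => s *: x).
Proof.
apply: measurable_fun_rV => i; rewrite (_ : _ \o _ = (fun x => s * rV_coord i x)%R).
  by apply: measurable_funM => //; exact: measurable_rV_coord.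
by apply/funext => x; rewrite /rV_coord/= mxE.
Qed.

(** The set measured on the left is the dilate s A. The rescaled image [m'] of Lebesgue measure
    gives each half-open interval its length, so it is Lebesgue measure. *)
Lemma lebesgue_measure_scale s (A : set (measurableTypeR R)) : (0 < s)%R ->
  measurable A ->
  lebesgue_measure [set x : R | A (s^-1 * x)%R] = s%:E * lebesgue_measure A.
Proof.
move=> s0 mA.
have mphi : measurable_fun setT (fun x : measurableTypeR R => (s^-1 * x)%R :
  measurableTypeR R)
  by exact: mulrl_measurable.
have k0 : (0 <= s^-1)%R by rewrite invr_ge0 ltW.
pose m' := mscale (NngNum k0) (image_measure lebesgue_measure mphi).
have -> : lebesgue_measure A = m' A.
  apply: (@lebesgue_measure_unique R m') => // X [[a b] _ <-]/=.
  rewrite /m' /mscale/= /pushforward.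
  have -> : [set` `](a, b).1, (a, b).2]] = `]a, b]%classic by [].
  rewrite (_ : _ @^-1` _ = `](s * a)%R, (s * b)%R]%classic); last first.
    apply/seteqP; split => x /=; rewrite !in_itv/=;
    by rewrite [(s^-1 * x)%R]mulrC ltr_pdivlMr// ler_pdivrMr//
      [(a * s)%R]mulrC [(b * s)%R]mulrC.
  rewrite !lebesgue_measure_itv/= !lte_fin ltr_pM2l//.
  case: ifPn => _; last by rewrite mule0.
  by rewrite -!EFinB -EFinM -mulrBr mulrA mulVf ?mul1r// gt_eqF.
rewrite /m' /mscale/= /pushforward muleA -EFinM divff ?mul1e// gt_eqF//.
Qed.

(** By induction and uniqueness of product measures it is enough to treat rectangles, whose sides
    contribute the factors s and s^n. *)
Lemma lebesgue_rV_scale n s (A : set 'rV[R]_n) : (0 < s)%R -> measurable A ->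
  lebesgue_rV n [set x | A (s^-1 *: x)] = (s ^+ n)%:E * lebesgue_rV n A.
Proof.
move=> s0; elim: n A => [|n IH] A mA.
  rewrite expr0 mul1e /= !diracE; congr (_ %:R%:E); congr nat_of_bool.
  by apply/idP/idP; rewrite !inE/= scaler0.
rewrite /= /cons_measure /pushforward.
set B := rV_cons (n := n) @^-1` A.
have mB : measurable B by rewrite -[B]setTI; exact: measurable_rV_cons.
pose phi (p : measurableTypeR R * 'rV[R]_n) : measurableTypeR R * 'rV[R]_n :=
  ((s^-1 * p.1)%R, s^-1 *: p.2).
have mphi : measurable_fun setT phi.
  apply: measurable_fun_pair.
    exact: measurableT_comp (mulrl_measurable _) measurable_fst.
  exact: measurableT_comp (measurable_rV_scale _) measurable_snd.
rewrite (_ : _ @^-1` _ = phi @^-1` B); last first.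
  apply/seteqP; split => -[a v]; rewrite /B /phi/=; congr A;
  by apply/rowP => i; rewrite !mxE; case: unliftP => [j|] _; rewrite ?mxE.
have k0 : (0 <= (s ^+ n.+1)^-1)%R by rewrite invr_ge0 exprn_ge0// ltW.
pose m' := mscale (NngNum k0) (image_measure (lebesgue_measure \x lebesgue_rV n) mphi).
have -> : (lebesgue_measure \x lebesgue_rV n) B = m' B.
  apply: product_measure_unique => // X Y mX mY.
  rewrite -[LHS]/(((s ^+ n.+1)^-1)%:E *
    (lebesgue_measure \x lebesgue_rV n) (phi @^-1` (X `*` Y))).
  rewrite (_ : phi @^-1` _ = [set x | X (s^-1 * x)%R] `*` [set x | Y (s^-1 *: x)])//.
  rewrite product_measure1E//; last 2 first.
  - by rewrite -[X in measurable X]setTI; exact: mulrl_measurable.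
  - by rewrite -[X in measurable X]setTI; exact: measurable_rV_scale.
  transitivity (((s ^+ n.+1)^-1)%:E *
      ((s%:E * lebesgue_measure X) * ((s ^+ n)%:E * lebesgue_rV n Y))).
    congr (_ * (_ * _)); last exact: IH.
    exact: lebesgue_measure_scale.
  rewrite muleACA -(EFinM s) -exprS [LHS]muleA -EFinM mulVf ?mul1e//.
  by rewrite expf_neq0// gt_eqF.
rewrite /m' /mscale/= /pushforward muleA -EFinM divff ?mul1e//.
by rewrite expf_neq0// gt_eqF.
Qed.

End scaling.

(** * The Euclidean norm *)

Section power_integral.
Local Open Scope ereal_scope.
Context {R : realType}.

Lemma continuous_powR_pos (p x : R) : (0 < x)%R -> {for x, continuous (@powR R ^~ p)}.
Proof.
move=> x0; apply: differentiable_continuous; apply/derivable1_diffP.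
exact: (@ex_derive _ _ _ _ _ _ _ (is_derive1_powR p x0)).
Qed.

(** The fundamental theorem of calculus away from 0. Both [c] and [p] may be negative; the exponents
    used later are [- d%:R], [d%:R / 2] and those of the estimates for Gamma. *)
Lemma integral_powR (c p a b : R) : (0 < a)%R -> (a < b)%R ->
  \int[lebesgue_measure]_(x in `]a, b]) (c * p * x `^ (p - 1))%:E =
  (c * (b `^ p - a `^ p))%:E.
Proof.
move=> a0 ab.
have pos x : (a <= x)%R -> (0 < x)%R by exact: lt_le_trans.
rewrite integral_itv_obnd_cbnd; last first.
  by apply/measurable_EFinP; apply: measurable_funM => //; exact: measurable_funTS.
rewrite (@continuous_FTC2 _ _ (fun x => c * x `^ p)%R)//.
- by rewrite mulrBr.
- apply: continuous_in_subspaceT => x; rewrite inE/= in_itv/= => /andP[ax _].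
  apply: cvgM; first exact: cvg_cst.
  exact/continuous_powR_pos/pos.
- have C x : (0 < x)%R -> {for x, continuous (fun x => c * x `^ p)%R}.
    by move=> x0; apply: cvgM; [exact: cvg_cst|exact: continuous_powR_pos].
  split.
  + move=> x; rewrite in_itv/= => /andP[ax _].
    apply: derivableM; first exact: derivable_cst.
    exact: (@ex_derive _ _ _ _ _ _ _ (is_derive1_powR p (pos _ (ltW ax)))).
  + by apply: cvg_at_right_filter; exact: C.
  + by apply: cvg_at_left_filter; apply: C; exact: lt_trans ab.
- move=> x; rewrite in_itv/= => /andP[ax _].
  have D := is_derive1_powR p (pos _ (ltW ax)).
  by rewrite derive1E deriveMl// derive_val -mulrA.
Qed.

End power_integral.

Section enorm.
Context {R : realType} {d : nat}.
Implicit Types (x y : 'rV[R]_d).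

Lemma dotC x y : dot x y = dot y x.
Proof. by apply: eq_bigr => i _; rewrite mulrC. Qed.

Lemma dotZl a x y : dot (a *: x) y = a * dot x y.
Proof. by rewrite /dot mulr_sumr; apply: eq_bigr => i _; rewrite mxE mulrA. Qed.

Lemma dotZr a x y : dot x (a *: y) = a * dot x y.
Proof. by rewrite dotC dotZl dotC. Qed.

Lemma dotDl x y z : dot (x + y) z = dot x z + dot y z.
Proof. by rewrite /dot -big_split; apply: eq_bigr => i _; rewrite mxE mulrDl. Qed.

Lemma dotDr x y z : dot x (y + z) = dot x y + dot x z.
Proof. by rewrite dotC dotDl dotC [dot z _]dotC. Qed.

Lemma dot0r x : dot x 0 = 0.
Proof. by rewrite /dot big1// => i _; rewrite mxE mulr0. Qed.

Lemma dotxx_ge0 x : 0 <= dot x x.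
Proof. by apply: sumr_ge0 => i _; rewrite -expr2 sqr_ge0. Qed.

Lemma enorm_ge0 x : 0 <= enorm x.
Proof. exact: sqrtr_ge0. Qed.

Lemma sqr_enorm x : enorm x ^+ 2 = dot x x.
Proof. by rewrite sqr_sqrtr// dotxx_ge0. Qed.

Lemma enormZ a x : enorm (a *: x) = `|a| * enorm x.
Proof. by rewrite /enorm dotZl dotZr mulrA -expr2 sqrtrM ?sqr_ge0// sqrtr_sqr. Qed.

Lemma enorm_eq0 x : (enorm x == 0) = (x == 0).
Proof.
apply/eqP/eqP => [|->]; last by rewrite /enorm dot0r sqrtr0.
move=> /(congr1 (fun z => z ^+ 2)); rewrite sqr_enorm expr0n/= => /eqP.
rewrite psumr_eq0; last by move=> i _; rewrite -expr2 sqr_ge0.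
move=> /allP x0; apply/rowP => i; rewrite mxE.
by have := x0 i (mem_index_enum _); rewrite /= mulf_eq0 orbb => /eqP.
Qed.

Lemma enorm_gt0 x : (0 < enorm x) = (x != 0).
Proof. by rewrite lt_neqAle enorm_ge0 andbT eq_sym enorm_eq0. Qed.

Lemma continuous_dot w : continuous (fun x : 'rV[R]_d => dot x w).
Proof.
apply: (@continuous_big R _ +%R); first exact: add_continuous.
move=> i _ x.
exact: (@continuousM _ _ (fun x : 'rV[R]_d => x 0 i) (cst (w 0 i)) x
  (@coord_continuous _ _ _ _ _ x) (@cst_continuous _ _ _ x)).
Qed.

Lemma measurable_dot d' (T : measurableType d') (f g : T -> 'rV[R]_d) :
  measurable_fun setT f -> measurable_fun setT g ->
  measurable_fun setT (fun t => dot (f t) (g t)).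
Proof.
move=> mf mg; apply: measurable_sum => i; apply: measurable_funM.
- exact: measurableT_comp (measurable_rV_coord i) mf.
- exact: measurableT_comp (measurable_rV_coord i) mg.
Qed.

Lemma measurable_enorm : measurable_fun setT (@enorm R d).
Proof.
apply: (@measurableT_comp _ _ _ _ _ _ (@Num.sqrt R)).
  by apply: continuous_measurable_fun; exact: sqrt_continuous.
exact: measurable_dot.
Qed.

(** The inverse is read as the power with exponent -1; both are 0 at the origin. *)
Lemma measurable_enormV : measurable_fun setT (fun x => (enorm x)^-1).
Proof.
rewrite (_ : (fun _ => _) = (fun x => enorm x `^ (-1))).
  exact: measurableT_comp (measurable_powR _) measurable_enorm.
by apply/funext => x; rewrite powR_inv1// enorm_ge0.
Qed.

(** The value at 0 is 0, as [0^-1 = 0]; this is why [cone] removes the origin explicitly. *)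
Definition direction x := (enorm x)^-1 *: x.

Lemma measurable_direction : measurable_fun setT direction.
Proof.
apply: measurable_fun_rV => i.
rewrite (_ : _ \o _ = (fun x => (enorm x)^-1 * rV_coord i x)).
  by apply: measurable_funM; [exact: measurable_enormV|exact: measurable_rV_coord].
by apply/funext => x; rewrite /rV_coord/= mxE.
Qed.

Lemma enorm_direction x : x != 0 -> enorm (direction x) = 1.
Proof.
move=> x0; rewrite enormZ ger0_norm ?invr_ge0 ?enorm_ge0//.
by rewrite mulVf// enorm_eq0.
Qed.

Lemma directionZ s x : 0 < s -> direction (s *: x) = direction x.
Proof.
move=> s0; rewrite /direction enormZ gtr0_norm// scalerA; congr (_ *: _).
by rewrite invfM mulrAC mulVf ?mul1r// gt_eqF.
Qed.

Lemma measurable_rV1 x : measurable [set x].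
Proof.
rewrite (_ : [set x] = \bigcap_(i in [set: 'I_d]) (rV_coord i @^-1` [set x 0 i])).
  apply: fin_bigcap_measurable => // i _.
  by rewrite -[X in measurable X]setTI; apply: measurable_rV_coord.
apply/seteqP; split => [y -> //|y xy]; apply/rowP => i; exact: (xy i).
Qed.

End enorm.

(** * Polar coordinates *)

Section gaussian.
Local Open Scope ereal_scope.
Context {R : realType}.

(** Used twice: it bounds the volume of the ball and, evaluated radially, it determines this
    volume. *)
Lemma integral_gauss_rV n :
  \int[lebesgue_rV n]_x (expR (- dot x x))%:E = (Num.sqrt pi ^+ n)%:E :> \bar R.
Proof.
have mE k : measurable_fun setT (fun x : 'rV[R]_k => (expR (- dot x x))%:E).
  apply/measurable_EFinP; apply: measurableT_comp => //.
  by apply: measurableT_comp => //; exact: measurable_dot.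
elim: n => [|n IH].
  rewrite /= integral_dirac//; last exact: mE.
  by rewrite diracT mul1e /dot big_ord0 oppr0 expR0.
rewrite /= /cons_measure ge0_integral_pushforward//=; last exact: mE.
rewrite preimage_setT.
pose f (p : measurableTypeR R * 'rV[R]_n) :=
  ((gauss_fun p.1) * expR (- dot p.2 p.2))%R.
under eq_integral => p _.
  rewrite (_ : (expR _)%:E = (f p)%:E); last first.
    rewrite /f /gauss_fun -expRD /dot big_ord_recl; congr (expR _)%:E.
    rewrite opprD; congr (- _ - _)%R; first by rewrite mxE unlift_none expr2.
    by apply: eq_bigr => i _; rewrite mxE liftK.
  over.
have mf : measurable_fun setT (EFin \o f).
  apply/measurable_EFinP; apply: measurable_funM.
    exact: measurableT_comp (measurable_gauss_fun) measurable_fst.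
  apply: (@measurableT_comp _ _ _ _ _ _ (fun v => expR (- dot v v))) => //.
  by apply/measurable_EFinP; exact: mE.
rewrite fubini_tonelli1//; last by move=> p; rewrite lee_fin /f mulr_ge0 ?expR_ge0.
have inner x : fubini_F (lebesgue_rV n) (EFin \o f) x =
    (gauss_fun x)%:E * (Num.sqrt pi ^+ n)%:E.
  rewrite /fubini_F -IH -ge0_integralZl// ?lee_fin ?expR_ge0//; exact: mE.
under eq_integral do rewrite inner.
rewrite ge0_integralZr// ?lee_fin ?exprn_ge0 ?sqrtr_ge0//; last first.
- by move=> x _; rewrite lee_fin expR_ge0.
- by apply/measurable_EFinP; exact: measurable_gauss_fun.
by rewrite integralT_gauss -EFinM exprS.
Qed.

End gaussian.

Section polar.
Local Open Scope ereal_scope.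
Context {R : realType} {d : nat}.
Implicit Types (A : set 'rV[R]_d) (s : R).

Definition cone A : set 'rV[R]_d := [set y | (y != 0)%R /\ A (direction y)].

Lemma measurable_cone A : measurable A -> measurable (cone A).
Proof.
move=> mA; rewrite (_ : cone A = ~` [set 0%R] `&` (direction @^-1` A)).
  apply: measurableI; first by apply: measurableC; exact: measurable_rV1.
  by rewrite -[X in measurable X]setTI; exact: measurable_direction.
by apply/seteqP; split => y [/eqP y0 Ay]; split => //; apply/eqP.
Qed.

Lemma measurable_enorm_preim (I : set (measurableTypeR R)) : measurable I ->
  measurable (@enorm R d @^-1` I).
Proof. by move=> mI; rewrite -[X in measurable X]setTI; exact: measurable_enorm. Qed.

Lemma measurable_closed_ball1 : measurable (@closed_ball1 R d).
Proof.
rewrite (_ : closed_ball1 = @enorm R d @^-1` `]-oo, 1%R]).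
  exact: measurable_enorm_preim.
by apply/seteqP; split => x; rewrite /closed_ball1/= in_itv.
Qed.

Lemma spherical_coneE A : spherical_cone A = cone A `&` closed_ball1.
Proof. by apply/seteqP; split => x; [case|case=> -[]]. Qed.

Lemma measurable_spherical_cone A : measurable A -> measurable (spherical_cone A).
Proof.
move=> mA; rewrite spherical_coneE; apply: measurableI.
- exact: measurable_cone.
- exact: measurable_closed_ball1.
Qed.

(** A Markov inequality: the Gaussian weight is at least exp(-1) on the ball and has finite total
    mass. *)
Lemma closed_ball1_fin : lebesgue_rV d (@closed_ball1 R d) < +oo.
Proof.
have : (expR (-1))%:E * lebesgue_rV d (@closed_ball1 R d) <= (Num.sqrt pi ^+ d)%:E.
  rewrite -integral_gauss_rV -integral_cst; last exact: measurable_closed_ball1.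
  apply: (@le_trans _ _ (\int[lebesgue_rV d]_(x in closed_ball1) (expR (- dot x
    x))%:E)).
    apply: ge0_le_integral => //.
    - exact: measurable_closed_ball1.
    - by move=> x _; rewrite lee_fin expR_ge0.
    - apply: measurable_funTS; apply/measurable_EFinP; apply: measurableT_comp => //.
      by apply: measurableT_comp => //; exact: measurable_dot.
    - move=> x; rewrite /closed_ball1/= => x1; rewrite lee_fin ler_expR lerN2.
      by rewrite -sqr_enorm expr_le1// enorm_ge0.
  apply: ge0_subset_integral => //.
  - exact: measurable_closed_ball1.
  - apply/measurable_EFinP; apply: measurableT_comp => //.
    by apply: measurableT_comp => //; exact: measurable_dot.
rewrite ltey; apply: contraTN => /eqP ->.
by rewrite gt0_muley ?lte_fin ?expR_gt0.
Qed.

Lemma spherical_cone_fin A : measurable A ->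
  lebesgue_rV d (spherical_cone A) < +oo.
Proof.
move=> mA; apply: le_lt_trans closed_ball1_fin; apply: le_measure; rewrite ?inE.
- exact: measurable_spherical_cone.
- exact: measurable_closed_ball1.
- by rewrite spherical_coneE; exact: subIsetr.
Qed.

Lemma cone_le A s : measurable A -> (0 < s)%R ->
  lebesgue_rV d (cone A `&` [set y | (enorm y <= s)%R]) =
  (s ^+ d)%:E * lebesgue_rV d (spherical_cone A).
Proof.
move=> mA s0; rewrite -lebesgue_rV_scale//; last exact: measurable_spherical_cone.
congr (lebesgue_rV d _); apply/seteqP; split => y;
  rewrite spherical_coneE /closed_ball1/=.
- move=> [[y0 Ay] ys]; split; last first.
    by rewrite enormZ gtr0_norm ?invr_gt0// mulrC ler_pdivrMr// mul1r.
  split; last by rewrite directionZ// invr_gt0.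
  by rewrite scaler_eq0 negb_or y0 andbT invr_eq0 gt_eqF.
- rewrite enormZ gtr0_norm ?invr_gt0// mulrC ler_pdivrMr// mul1r.
  move=> [[y0 Ay] ys]; split => //; split.
    by apply: contra y0 => /eqP ->; rewrite scaler0.
  by move: Ay; rewrite directionZ// invr_gt0.
Qed.

(** Exhaustion from within by the radii s (1 - 1/(k+2)), which avoids showing that spheres are null
    sets. The strict version is needed because inverting the norm moves the open end of ]a, b] to
    the outer radius. *)
Lemma cone_lt A s : measurable A -> (0 < s)%R ->
  lebesgue_rV d (cone A `&` [set y | (enorm y < s)%R]) =
  (s ^+ d)%:E * lebesgue_rV d (spherical_cone A).
Proof.
move=> mA s0; pose t k : R := (s * (1 - harmonic k.+1))%R.
have t0 k : (0 < t k)%R.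
  by rewrite mulr_gt0// subr_gt0 invf_lt1 ?ltr1n.
have ts k : (t k < s)%R by rewrite gtr_pMr// gtrBl invr_gt0.
have tcvg : t @ \oo --> s.
  rewrite -[X in _ --> X]mulr1; apply: cvgMr.
  rewrite -[X in _ --> X]subr0; apply: cvgB; first exact: cvg_cst.
  by rewrite (cvg_shiftS (@harmonic R)); exact: cvg_harmonic.
pose F k := cone A `&` [set y | (enorm y <= t k)%R].
have mF k : measurable (F k).
  apply: measurableI; first exact: measurable_cone.
  rewrite (_ : [set _ | _] = @enorm R d @^-1` `]-oo, t k]).
    exact: measurable_enorm_preim.
  by apply/seteqP; split => x; rewrite /= in_itv.
have FE : cone A `&` [set y | (enorm y < s)%R] = \bigcup_k F k.
  apply/seteqP; split => [y [Ay /= ys]|y [k _ [Ay /= yk]]]; last first.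
    by split => //=; exact: le_lt_trans (ts k).
  have [k _ /(_ k (leqnn k))/= yk] : \forall k \near \oo, (enorm y <= t k)%R.
    by apply: cvgr_ge ys; exact: tcvg.
  by exists k.
rewrite FE; apply: (@cvg_unique _ _ (lebesgue_rV d \o F @ \oo)) => //.
  apply: nondecreasing_cvg_mu => //; first exact: bigcupT_measurable.
  move=> m n mn; apply/subsetPset; apply: setIS => y /= /le_trans; apply.
  by rewrite ler_wpM2l ?(ltW s0)// lerD2l lerN2 lef_pV2 ?posrE// ler_nat !ltnS.
rewrite (_ : _ \o _ = fun k => (t k ^+ d)%:E * lebesgue_rV d (spherical_cone A)).
  apply: cvgeZr; first by rewrite ge0_fin_numE// spherical_cone_fin.
  apply/fine_cvgP; split; first by near=> k.
  exact: (cvg_comp t (fun x => x ^+ d)%R tcvg (@exprn_continuous _ d s)).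
by apply/funext => k /=; rewrite cone_le.
Unshelve. all: by end_near.
Qed.

End polar.

Section radial_pushforward.
Local Open Scope ereal_scope.
Context {R : realType} {d : nat}.
Variables (A : set 'rV[R]_d) (mA : measurable A).

Let kappa : R := fine (lebesgue_rV d (spherical_cone A)).

Let kappaE : lebesgue_rV d (spherical_cone A) = kappa%:E.
Proof. by rewrite fineK// ge0_fin_numE// spherical_cone_fin. Qed.

Let kappa_ge0 : (0 <= kappa)%R.
Proof. exact: fine_ge0. Qed.

(** It is enough to know the mass of the shells [a < rho y <= b] in the cone: they determine the
    image of Lebesgue measure under [rho] on the half-line. *)
Let pushforward_on_cone (rho : 'rV[R]_d -> R) (g h : R -> R)
    (I : set (measurableTypeR R)) :
  measurable_fun setT rho ->
  (forall x, (0 <= g x)%R) -> measurable_fun setT g ->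
  (forall a b, (0 < a)%R -> (a < b)%R ->
    lebesgue_rV d (cone A `&` [set y | (a < rho y <= b)%R]) =
      \int[lebesgue_measure]_(x in `]a, b]) (g x)%:E /\
    lebesgue_rV d (cone A `&` [set y | (a < rho y <= b)%R]) < +oo) ->
  (forall x, (0 <= h x)%R) -> measurable_fun setT h ->
  measurable I -> I `<=` `]0%R, +oo[ ->
  \int[lebesgue_rV d]_(y in cone A `&` rho @^-1` I) (h (rho y))%:E =
  \int[lebesgue_measure]_(r in I) (h r * g r)%:E.
Proof.
move=> mrho g0 mg rhoE h0 mh mI I0.
(* [phi] is [0], hence not in [I], outside of the cone. *)
pose phi (y : 'rV[R]_d) : measurableTypeR R := (\1_(cone A) y * rho y)%R.
have mphi : measurable_fun setT phi.
  by apply: measurable_funM => //; apply: measurable_indic; exact: measurable_cone.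
have phiE J : J `<=` `]0%R, +oo[ -> phi @^-1` J = cone A `&` rho @^-1` J.
  move=> J0; apply/seteqP; split => [y|y [Ay]]; rewrite /phi/= indicE; last first.
    by rewrite mem_set// mul1r.
  case: (boolP (y \in cone A)) => [/set_mem yA|_]; first by rewrite mul1r.
  by rewrite mul0r => /J0; rewrite /= in_itv/= ltxx.
have nuE := @density_positive_reals R (image_measure (lebesgue_rV d) mphi) g g0 mg.
transitivity (\int[image_measure (lebesgue_rV d) mphi]_(r in I) (h r)%:E).
  rewrite [RHS]ge0_integral_pushforward//; last 2 first.
  - by apply/measurable_EFinP; exact: measurable_funTS.
  - by move=> x _; rewrite lee_fin.
  rewrite phiE//; apply: eq_integral => y /set_mem[Ay _].
  by rewrite /= /phi indicE mem_set// mul1r.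
rewrite (@ge0_integral_density _ _ _ lebesgue_measure _ _ mI g)//.
- move=> J mJ JI; apply: nuE => //; last exact: subset_trans I0.
  move=> a b a0 ab; rewrite /image_measure/= /pushforward phiE.
    have -> : rho @^-1` `]a, b] = [set y | (a < rho y <= b)%R].
      by apply/seteqP; split => y; rewrite /= in_itv.
    exact: rhoE.
  by move=> x; rewrite /= !in_itv/= andbT => /andP[/(lt_trans a0)].
- by apply/measurable_EFinP; exact: measurable_funTS.
- by move=> x _; rewrite lee_fin.
Qed.

(** The shell 1/b <= |y| < 1/a has mass kappa (a^-d - b^-d), whence the density kappa d r^(-d-1).
    The variable 1/|y| is the radius of the constraint that [y] imposes on the dual. *)
Lemma integral_cone_enormV (h : R -> R) (I : set (measurableTypeR R)) :
  (forall x, (0 <= h x)%R) -> measurable_fun setT h ->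
  measurable I -> I `<=` `]0%R, +oo[ ->
  \int[lebesgue_rV d]_(y in cone A `&` (fun y => (enorm y)^-1)%R @^-1` I)
    (h (enorm y)^-1)%:E =
  \int[lebesgue_measure]_(r in I) (h r * (kappa * d%:R * r `^ (- d%:R - 1)))%:E.
Proof.
move=> h0 mh mI I0; apply: pushforward_on_cone => //.
- exact: measurable_enormV.
- by move=> x; rewrite !mulr_ge0// powR_ge0.
- by apply: measurable_funM.
move=> a b a0 ab; have b0 := lt_trans a0 ab.
have mlt s : measurable (cone A `&` [set y | (enorm y < s)%R]).
  apply: measurableI; first exact: measurable_cone.
  rewrite (_ : [set _ | _] = @enorm R d @^-1` `]-oo, s[).
    exact: measurable_enorm_preim.
  by apply/seteqP; split => x; rewrite /= in_itv.
have -> : cone A `&` [set y | (a < (enorm y)^-1 <= b)%R] =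
    (cone A `&` [set y | (enorm y < a^-1)%R]) `\`
    (cone A `&` [set y | (enorm y < b^-1)%R]).
  apply/seteqP; split => y /=.
    move=> [[y0 Ay] /andP[ay yb]]; have y_gt0 : (0 < enorm y)%R by rewrite enorm_gt0.
    split; first by split => //; rewrite -[ltLHS]invrK ltf_pV2 ?posrE ?invr_gt0.
    move=> [_]; apply/negP; rewrite -leNgt.
    by rewrite -[leRHS]invrK lef_pV2 ?posrE ?invr_gt0.
  move=> [[[y0 Ay] ya] yb]; have y_gt0 : (0 < enorm y)%R by rewrite enorm_gt0.
  split; first by [].
  apply/andP; split; first by rewrite -[ltLHS]invrK ltf_pV2 ?posrE ?invr_gt0.
  rewrite -[leRHS]invrK lef_pV2 ?posrE ?invr_gt0// leNgt.
  by apply/negP => yb'; apply: yb; split.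
have mfin s : (0 < s)%R -> lebesgue_rV d (cone A `&` [set y | (enorm y < s)%R]) < +oo.
  by move=> s0; rewrite cone_lt// kappaE -EFinM ltry.
have -> : lebesgue_rV d ((cone A `&` [set y | (enorm y < a^-1)%R]) `\`
    (cone A `&` [set y | (enorm y < b^-1)%R])) =
  lebesgue_rV d (cone A `&` [set y | (enorm y < a^-1)%R]) -
  lebesgue_rV d (cone A `&` [set y | (enorm y < b^-1)%R]).
  rewrite measureD//; last by apply: mfin; rewrite ?invr_gt0.
  congr (_ - lebesgue_rV d _); apply: setIidr => y [Ay /= yb]; split => //=;
    rewrite (lt_le_trans yb)//.
  by rewrite lef_pV2 ?posrE// ltW.
rewrite !cone_lt ?invr_gt0// kappaE -!EFinM -EFinB; split; last by rewrite ltry.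
(* The two signs make [integral_powR] applicable with [c = - kappa] and [p = - d%:R]. *)
have -> : (fun x => (kappa * d%:R * x `^ (- d%:R - 1))%:E) =
    (fun x => (- kappa * - d%:R * x `^ (- d%:R - 1))%:E).
  by apply/funext => x; rewrite mulrNN.
rewrite integral_powR//; congr EFin.
by rewrite !powR_invn ?ltW// mulNr -mulrN opprB mulrBr !exprVn ![(kappa * _)%R]mulrC.
Qed.

(** The variable |y|^2 turns the Gaussian weight into exp(-r) against r^(d/2 - 1), the integrand of
    Gamma at d/2. *)
Lemma integral_cone_enorm2 (h : R -> R) (I : set (measurableTypeR R)) :
  (forall x, (0 <= h x)%R) -> measurable_fun setT h ->
  measurable I -> I `<=` `]0%R, +oo[ ->
  \int[lebesgue_rV d]_(y in cone A `&` (fun y => (enorm y) ^+ 2)%R @^-1` I)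
    (h ((enorm y) ^+ 2)%R)%:E =
  \int[lebesgue_measure]_(r in I)
     (h r * (kappa * (d%:R / 2) * r `^ (d%:R / 2 - 1)))%:E.
Proof.
move=> h0 mh mI I0; apply: pushforward_on_cone => //.
- by apply: measurable_funX; exact: measurable_enorm.
- by move=> x; rewrite !mulr_ge0// powR_ge0.
- by apply: measurable_funM.
move=> a b a0 ab; have b0 := lt_trans a0 ab.
have mle s : measurable (cone A `&` [set y | (enorm y <= s)%R]).
  apply: measurableI; first exact: measurable_cone.
  rewrite (_ : [set _ | _] = @enorm R d @^-1` `]-oo, s]).
    exact: measurable_enorm_preim.
  by apply/seteqP; split => x; rewrite /= in_itv.
have sqr_le y s : (0 < s)%R -> (enorm y ^+ 2 <= s)%R = (enorm (y :
  'rV[R]_d) <= Num.sqrt s)%R.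
  move=> s0; rewrite -[RHS](@ler_pXn2r _ 2) ?nnegrE ?enorm_ge0 ?sqrtr_ge0//.
  have -> : (Num.sqrt s ^+ 2 = s)%R by exact: sqr_sqrtr (ltW s0).
  by [].
have -> : cone A `&` [set y | (a < enorm y ^+ 2 <= b)%R] =
    (cone A `&` [set y | (enorm y <= Num.sqrt b)%R]) `\`
    (cone A `&` [set y | (enorm y <= Num.sqrt a)%R]).
  apply/seteqP; split => y /=; rewrite ltNge !sqr_le//.
    by move=> [Ay /andP[/negP ay yb]]; split => // -[_].
  move=> [[Ay yb] ay]; split => //; rewrite yb andbT.
  by apply/negP => ya; apply: ay.
have mfin s : (0 < s)%R -> lebesgue_rV d (cone A `&` [set y | (enorm y <= s)%R]) < +oo.
  by move=> s0; rewrite cone_le// kappaE -EFinM ltry.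
have -> : lebesgue_rV d ((cone A `&` [set y | (enorm y <= Num.sqrt b)%R]) `\`
    (cone A `&` [set y | (enorm y <= Num.sqrt a)%R])) =
  lebesgue_rV d (cone A `&` [set y | (enorm y <= Num.sqrt b)%R]) -
  lebesgue_rV d (cone A `&` [set y | (enorm y <= Num.sqrt a)%R]).
  rewrite measureD//; last by apply: mfin; rewrite ?sqrtr_gt0.
  congr (_ - lebesgue_rV d _); apply: setIidr => y [Ay /= yb]; split => //=;
    rewrite (le_trans yb)//.
  by rewrite ler_sqrt// ltW.
rewrite !cone_le ?sqrtr_gt0// kappaE -!EFinM -EFinB; split; last by rewrite ltry.
have sqrtX s : (0 < s)%R -> (Num.sqrt s ^+ d = s `^ (d%:R / 2))%R.
  move=> s0; rewrite -powR12_sqrt ?ltW// -powR_mulrn ?powR_ge0// -powRrM.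
  by rewrite mulrC.
by rewrite integral_powR// !sqrtX// mulrBr ![(kappa * _)%R]mulrC.
Qed.

End radial_pushforward.

(** * The Gamma function and the volume of the ball *)

Section Gamma_pos.
Context {R : realType}.

(** The constant is p^p: raise t/p <= exp(t/p) to the power p and multiply by p^p. *)
Lemma powR_expRN_bound (p : R) : 0 < p ->
  exists2 C : R, 0 <= C & forall t, 0 < t -> t `^ p * expR (- t) <= C.
Proof.
move=> p0; exists (p `^ p); first exact: powR_ge0.
move=> t t0; rewrite expRN ler_pdivrMr ?expR_gt0//.
have tE : p * (t / p) = t by rewrite mulrCA divff ?mulr1// gt_eqF.
have tp0 : 0 <= t / p by rewrite divr_ge0// ltW.
rewrite -{1}tE powRM// ?(ltW p0)// ler_wpM2l ?powR_ge0//.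
rewrite -[in leRHS]tE [p * _]mulrC expRM.
apply: ge0_ler_powR; rewrite ?nnegrE ?(ltW p0) ?expR_ge0//.
by rewrite (le_trans _ (expR_ge1Dx _))// lerDr.
Qed.

(** [Gamma] takes the [fine] part of this integral, so its value is meaningful only once finiteness
    is known. On ]0, 1] the integrand is at most t^(x-1), which contributes at most 1/x; beyond 1
    the preceding bound at p = x + 1 gives C t^-2, which contributes at most C. *)
Lemma integral_Gamma_fin (x : R) : 0 < x ->
  (\int[lebesgue_measure]_(t in `]0%R, +oo[) (t `^ (x - 1) * expR (- t))%:E < +oo)%E.
Proof.
move=> x0; pose f (t : R) := t `^ (x - 1) * expR (- t).
have f0 t : 0 <= f t by rewrite mulr_ge0 ?powR_ge0 ?expR_ge0.
have mf : measurable_fun setT (EFin \o f).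
  apply/measurable_EFinP; apply: measurable_funM => //.
  by apply: measurableT_comp => //; exact: measurableT_comp.
have x10 : 0 < x + 1 by rewrite addr_gt0.
have [C C0 CE] := powR_expRN_bound x10.
pose F (k : nat) : set R := `]k.+1%:R^-1, k.+2%:R]%classic.
have FE : `]0%R, +oo[%classic = \bigcup_k F k.
  apply/seteqP; split => [t|t [k _]]; rewrite /F/= !in_itv/= ?andbT; last first.
    by move=> /andP[+ _]; apply: le_lt_trans; rewrite invr_ge0.
  move=> t0; pose k := maxn (Num.bound t) (Num.bound t^-1).
  exists k => //; rewrite /= in_itv/=; apply/andP; split.
    rewrite -[ltRHS]invrK ltf_pV2 ?posrE ?invr_gt0//.
    rewrite (lt_le_trans (archi_boundP _)) ?invr_ge0 ?(ltW t0)//.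
    by rewrite ler_nat ltnW// ltnS leq_maxr.
  rewrite ltW// (lt_le_trans (archi_boundP (ltW t0)))//.
  by rewrite ler_nat -addn2 (leq_trans (leq_maxl _ (Num.bound t^-1)))// leq_addr.
have ndF : nondecreasing_seq F.
  move=> m n mn; apply/subsetPset => t; rewrite /F/= !in_itv/= => /andP[mt tm].
  apply/andP; split; first by rewrite (le_lt_trans _ mt)// lef_pV2 ?posrE// ler_nat.
  by rewrite (le_trans tm)// ler_nat.
have mF k : measurable (F k) by exact: measurable_itv.
suff bnd k : (\int[lebesgue_measure]_(t in F k) (f t)%:E <= (x^-1 + C)%:E)%E.
  apply: (@le_lt_trans _ _ (x^-1 + C)%:E); last by rewrite ltry.
  have c : (\int[lebesgue_measure]_(t in F k) (f t)%:E @[k --> \oo] -->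
      \int[lebesgue_measure]_(t in \bigcup_k F k) (f t)%:E)%E.
    apply: ge0_nondecreasing_set_cvg_integral => //.
    - by move=> k; exact: measurable_funTS.
    - by move=> k t _; rewrite lee_fin.
  by rewrite FE; apply: (cvge_to_le c); apply: nearW => k; exact: bnd.
have k1 : k.+1%:R^-1 <= 1 :> R by rewrite invf_le1 ?ler1n.
have k2 : 1 < k.+2%:R :> R by rewrite ltr1n.
have kk : F k = `]k.+1%:R^-1, 1]%classic `|` `]1, k.+2%:R]%classic.
  by rewrite -itv_bndbnd_setU ?bnd_simp// ltW.
rewrite kk ge0_integral_setU//; last 3 first.
- exact: measurable_funTS.
- by move=> t _; rewrite lee_fin.
- apply/disj_setPS => t [/=]; rewrite !in_itv/= => /andP[_ t1] /andP[+ _].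
  by rewrite ltNge t1.
rewrite EFinD; apply: leeD.
  (* For [k = 0] the left piece is ]1, 1]; it is empty and treated apart, since [integral_powR]
     requires [a < b]. *)
  have [->|k1'] := eqVneq (k.+1%:R^-1 : R) 1.
    by rewrite set_itv_ge ?bnd_simp ?ltxx// integral_set0 lee_fin invr_ge0 ltW.
  have {}k1 : k.+1%:R^-1 < 1 :> R by rewrite lt_neqAle k1' k1.
  apply: (@le_trans _ _ (\int[lebesgue_measure]_(t in `](k.+1%:R^-1)%R,
    1%R]) (x^-1 * x * t `^ (x - 1))%:E)%E).
    apply: ge0_le_integral => //.
    - by move=> t _; rewrite lee_fin.
    - exact: measurable_funTS.
    - by apply: measurable_funTS; apply/measurable_EFinP; apply: measurable_funM.
    - move=> t; rewrite /= in_itv/= => /andP[kt _]; have t0 : 0 <= t.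
        by rewrite ltW// (le_lt_trans _ kt)// invr_ge0.
      rewrite lee_fin mulVf ?gt_eqF// mul1r ler_piMr ?powR_ge0//.
      by rewrite expR_le1 oppr_le0.
  rewrite integral_powR ?invr_gt0// lee_fin -[leRHS]mulr1 ler_wpM2l ?invr_ge0 ?(ltW
    x0)//.
  by rewrite powR1 gerBl powR_ge0.
apply: (@le_trans _ _ (\int[lebesgue_measure]_(t in `]1%R,
  (k.+2%:R)%R]) ((- C) * -1 * t `^ (-1 - 1))%:E)%E).
  apply: ge0_le_integral => //.
  - by move=> t _; rewrite lee_fin.
  - exact: measurable_funTS.
  - by apply: measurable_funTS; apply/measurable_EFinP; apply: measurable_funM.
  - move=> t; rewrite /= in_itv/= => /andP[t1 _]; have t0 : 0 < t by exact: lt_trans t1.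
    rewrite lee_fin /f mulrN1 opprK (_ : x - 1 = (x + 1) + (-1 - 1)); last by ring.
    rewrite powRD; last by rewrite (gt_eqF t0) implybT.
    by rewrite mulrAC ler_wpM2r ?powR_ge0// CE.
rewrite integral_powR// lee_fin powR1 mulNr -mulrN opprB -[leRHS]mulr1 ler_wpM2l//
  gerBl powR_ge0.
Qed.

Lemma Gamma_gt0 (x : R) : 0 < x -> 0 < Gamma x.
Proof.
move=> x0; rewrite /Gamma /Rintegral fine_gt0// integral_Gamma_fin// andbT.
(* On ]1, 2], t^(x-1) >= t^-1 >= 1/2 because x > 0, and exp(-t) >= exp(-2). *)
pose c : R := 2^-1 * expR (- 2).
have c0 : 0 < c by rewrite mulr_gt0 ?expR_gt0.
apply: (@lt_le_trans _ _ (\int[lebesgue_measure]_(t in `]1%R, 2%R]) c%:E)%E).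
  rewrite integral_cst//= lebesgue_measure_itv/= lte_fin ltr1n/=.
  by rewrite -EFinB -EFinM lte_fin mulr_gt0// subr_gt0 ltr1n.
have mf : measurable_fun setT (fun t : R => (t `^ (x - 1) * expR (- t))%:E).
  apply/measurable_EFinP; apply: measurable_funM => //.
  by apply: measurableT_comp => //; exact: measurableT_comp.
apply: (@le_trans _ _ (\int[lebesgue_measure]_(t in `]1%R,
  2%R]) (t `^ (x - 1) * expR (- t))%:E)%E).
  apply: ge0_le_integral => //.
  - by move=> t _; rewrite lee_fin ltW.
  - exact: measurable_funTS.
  - move=> t; rewrite /= in_itv/= => /andP[t1 t2]; rewrite lee_fin.
    rewrite ler_pM ?expR_ge0 ?ler_expR ?lerN2//.
    apply: (@le_trans _ _ (t `^ (-1))); last by apply: ler_powR;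
      rewrite ?(ltW t1)// lerDr ltW.
    by rewrite powR_inv1 ?(le_trans ler01 (ltW t1))//
      lef_pV2 ?posrE ?(lt_trans ltr01 t1)//.
apply: ge0_subset_integral => //.
- exact: measurable_funTS.
- by move=> t _; rewrite lee_fin mulr_ge0 ?powR_ge0 ?expR_ge0.
- by move=> t; rewrite /= !in_itv/= andbT => /andP[t1 _]; exact: lt_trans t1.
Qed.

End Gamma_pos.

Section ball_volume.
Context {R : realType} {d : nat} (d_gt0 : (0 < d)%N).

(** The origin is invariant under dilation by 2, so its finite mass equals 2^d times itself; [d_gt0]
    forces it to vanish. *)
Lemma lebesgue_rV_set0 : lebesgue_rV d [set 0%R : 'rV[R]_d] = 0%E.
Proof.
have s0 : 0 < 2 :> R by [].
have := lebesgue_rV_scale s0 (measurable_rV1 (0 : 'rV[R]_d)).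
rewrite (_ : [set x | _] = [set 0]); last first.
  apply/seteqP; split => x /=; last by move=> ->; rewrite scaler0.
  by move/eqP; rewrite scaler_eq0 invr_eq0 gt_eqF//= => /eqP.
have : (lebesgue_rV d [set 0%R : 'rV[R]_d] < +oo)%E.
  apply: le_lt_trans (@closed_ball1_fin R d); apply: le_measure; rewrite ?inE.
  - exact: measurable_rV1.
  - exact: measurable_closed_ball1.
  - by move=> _ ->; rewrite /closed_ball1/= /enorm dot0r sqrtr0.
rewrite -ge0_fin_numE// => /fineK <-; set k := fine _.
rewrite -EFinM => /eqP; rewrite eqe -subr_eq0 -{1}[k]mul1r -mulrBl mulf_eq0 subr_eq0.
have -> : (1 == 2 ^+ d :> R) = false by rewrite lt_eqF// exprn_egt1// ?ltr1n// -lt0n.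
by move=> /eqP ->.
Qed.

Lemma spherical_coneT : lebesgue_rV d (spherical_cone [set: 'rV[R]_d]) =
  lebesgue_rV d (@closed_ball1 R d).
Proof.
rewrite (_ : spherical_cone _ = @closed_ball1 R d `\` [set 0]); last first.
  by apply/seteqP; split => x; [case=> /eqP x0|case=> x1 /eqP x0].
have mb := @measurable_closed_ball1 R d.
rewrite measureD//; last 2 first.
- exact: measurable_rV1.
- exact: closed_ball1_fin.
rewrite [X in (_ - X)%E](_ : _ = 0%E) ?sube0//.
apply/eqP; rewrite eq_le measure_ge0 andbT -lebesgue_rV_set0.
apply: le_measure; rewrite ?inE.
- by apply: measurableI => //; exact: measurable_rV1.
- exact: measurable_rV1.
- exact: subIsetr.
Qed.

Definition ball_volume : R := fine (lebesgue_rV d (@closed_ball1 R d)).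

Lemma ball_volume_ge0 : 0 <= ball_volume.
Proof. exact: fine_ge0. Qed.

(* Radial integration of the Gaussian weight [exp(-|y|^2)]. *)
Lemma ball_volume_Gamma :
  ball_volume * (d%:R / 2) * Gamma (d%:R / 2) = pi `^ (d%:R / 2).
Proof.
have d2 : 0 < d%:R / 2 :> R by rewrite divr_gt0// ltr0n.
have -> : pi `^ (d%:R / 2) = Num.sqrt pi ^+ d :> R.
  by rewrite -powR12_sqrt ?pi_ge0// -powR_mulrn ?powR_ge0// -powRrM mulrC.
apply: EFin_inj; rewrite -integral_gauss_rV.
pose h (t : R) := expR (- t).
have mh : measurable_fun setT h by exact: measurableT_comp.
have := @integral_cone_enorm2 R d setT measurableT h `]0, +oo[%classic
  (fun=> expR_ge0 _) mh (measurable_itv _) (fun _ => id).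
rewrite spherical_coneT -/ball_volume.
have mg : measurable_fun setT (fun x : 'rV[R]_d => (h (enorm x ^+ 2))%:E).
  apply/measurable_EFinP; apply: (@measurableT_comp _ _ _ _ _ _ h) => //.
  by apply: measurable_funX; exact: measurable_enorm.
have -> : cone setT `&` (fun y : 'rV[R]_d => enorm y ^+ 2) @^-1` `]0, +oo[ = ~` [set 0].
  apply/seteqP; split => [y [[/eqP]]//|y /eqP y0]; split => //.
  by rewrite /= in_itv/= andbT exprn_gt0// enorm_gt0.
have <- : (\int[lebesgue_rV d]_x (h (enorm x ^+ 2))%:E =
    \int[lebesgue_rV d]_(y in ~` [set 0%R]) (h (enorm y ^+ 2))%:E)%E.
  rewrite -(setUv [set 0%R : 'rV[R]_d]) ge0_integral_setU//.
  - rewrite [X in (X + _)%E](_ : _ = 0%E) ?add0e//.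
    apply: null_set_integral => //.
    + exact: measurable_rV1.
    + exact: measurable_funTS.
    + exact: lebesgue_rV_set0.
  - exact: measurable_rV1.
  - by apply: measurableC; exact: measurable_rV1.
  - by rewrite setUv.
  - by move=> x _; rewrite lee_fin expR_ge0.
  - by apply/disj_setPS => x [].
under eq_integral do rewrite /h sqr_enorm.
move=> ->; rewrite /Gamma /Rintegral.
have mG : measurable_fun setT (fun t : R => (t `^ (d%:R / 2 - 1) * expR (- t))%:E).
  by apply/measurable_EFinP; apply: measurable_funM; [exact: measurable_powR|exact: mh].
transitivity (\int[lebesgue_measure]_(t in `]0%R, +oo[)
  ((ball_volume * (d%:R / 2))%:E * (t `^ (d%:R / 2 - 1) * expR (- t))%:E))%E;
    last first.
  by apply: eq_integral => t _; rewrite -EFinM; congr EFin; rewrite /h; ring.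
rewrite ge0_integralZl//.
- rewrite EFinM fineK// ge0_fin_numE ?integral_Gamma_fin//.
  by apply: integral_ge0 => t _; rewrite lee_fin mulr_ge0 ?powR_ge0 ?expR_ge0.
- exact: measurable_funTS.
- by move=> t _; rewrite lee_fin mulr_ge0 ?powR_ge0 ?expR_ge0.
- by rewrite lee_fin mulr_ge0 ?ball_volume_ge0// ltW.
Qed.

Lemma ball_volume_gt0 : 0 < ball_volume.
Proof.
rewrite lt_neqAle ball_volume_ge0 andbT eq_sym; apply/negP => /eqP v0.
have := ball_volume_Gamma; rewrite v0 !mul0r => /esym/eqP.
by rewrite gt_eqF// powR_gt0// pi_gt0.
Qed.

Lemma omegaE : omega d = d%:R * ball_volume.
Proof.
have d2 : 0 < d%:R / 2 :> R by rewrite divr_gt0// ltr0n.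
rewrite /omega -ball_volume_Gamma mulrA mulfK ?gt_eqF ?Gamma_gt0//.
by field.
Qed.

End ball_volume.

(** * Matching the two intensities *)

Section polar_intensity.
Local Open Scope ereal_scope.
Context {R : realType} {d : nat} (d_gt0 : (0 < d)%N) (lambda beta : R).
Hypotheses (lambda_gt0 : (0 < lambda)%R) (beta_gt0 : (0 < beta)%R)
  (beta_gt : (d%:R / 2 < beta)%R).

Let alpha := (lambda / (ctilde d beta * omega d))%R.

Lemma ctilde_gt0 : (0 < ctilde d beta)%R.
Proof.
by rewrite /ctilde divr_gt0 ?mulr_gt0 ?powR_gt0 ?pi_gt0 ?Gamma_gt0 ?subr_gt0.
Qed.

(** Substitute r = 1/|y|: (r^-2 - 1)^(-beta) equals r^(2 beta) (1 - r^2)^(-beta), and the polar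
    density r^(-d-1) completes the exponent 2 beta - d - 1. For the constants, alpha times [ctilde]
    is lambda / (d v), with v the volume of the ball; the polar factor kappa d leaves lambda kappa /
    v, and kappa / v is [uniform_sphere A]. *)
Lemma beta_star_intensity_polar (A : set 'rV[R]_d) (I : set (measurableTypeR R)) :
  measurable A -> measurable I -> I `<=` `]0%R, 1%R[ ->
  beta_star_intensity alpha beta (cone A `&` (fun y => (enorm y)^-1)%R @^-1` I) =
  uniform_sphere A * zero_cell_intensity d lambda beta I.
Proof.
move=> mA mI I01.
have I0 : I `<=` `]0%R, +oo[.
  by move=> x /I01; rewrite /= !in_itv/= andbT => /andP[].
have v0 := @ball_volume_gt0 R d d_gt0.
have c0 := ctilde_gt0.
rewrite /beta_star_intensity /zero_cell_intensity (setIidl I01).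
set B := cone A `&` _.
have -> : B `\` closed_ball1 = B.
  apply/seteqP; split => [y []//|y [[y0 Ay] By]]; split => //.
  rewrite /closed_ball1/= => y1; have /= := I01 _ By; rewrite in_itv/= => /andP[_].
  by rewrite invf_lt1 ?enorm_gt0// ltNge y1.
pose h r := (alpha * ctilde d beta * (r `^ (- 2%:R) - 1) `^ (- beta))%R.
transitivity (\int[lebesgue_rV d]_(y in B) (h (enorm y)^-1)%:E).
  apply: eq_integral => y /set_mem[[y0 _] _]; congr (_ * _ `^ _)%:E.
  by rewrite powR_invn ?invr_ge0 ?enorm_ge0// -exprVn invrK.
rewrite integral_cone_enormV//; last 2 first.
- move=> x; rewrite mulr_ge0 ?powR_ge0// mulr_ge0 ?(ltW c0)//
    divr_ge0 ?(ltW lambda_gt0)//.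
  by rewrite mulr_ge0 ?(ltW c0)// omegaE// mulr_ge0// ltW.
- apply: measurable_funM => //.
  apply: (@measurableT_comp _ _ _ _ _ _ (fun x => x `^ (- beta))%R) => //.
  exact: measurable_funB.
rewrite /uniform_sphere; set k := fine (lebesgue_rV d (spherical_cone A)).
have k0 : (0 <= k)%R by exact: fine_ge0.
rewrite -ge0_integralZl//; last 3 first.
- apply: measurable_funTS; apply/measurable_EFinP; apply: measurable_funM => //.
  apply: measurable_funM => //.
  rewrite (_ : (fun x : R => _) = (fun x : R => (1 - x ^+ 2) `^ (- beta))%R);
    last first.
    by apply/funext => x; rewrite powRN.
  apply: (@measurableT_comp _ _ _ _ _ _ (fun x => x `^ (- beta))%R) => //.
  by apply: measurable_funB => //; exact: measurable_funX.
- by move=> x _; rewrite lee_fin mulr_ge0 ?divr_ge0 ?powR_ge0// ltW.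
- by rewrite lee_fin divr_ge0// ltW.
apply: eq_integral => r /set_mem/I01; rewrite /= in_itv/= => /andP[r0 r1].
rewrite -EFinM; congr EFin; rewrite /h -/(@ball_volume R d).
have d0 : (d%:R != 0 :> R)%R by rewrite pnatr_eq0 -lt0n.
have aE : (alpha * ctilde d beta = lambda / (d%:R * @ball_volume R d))%R.
  by rewrite /alpha omegaE//; field; rewrite (gt_eqF v0) d0 (gt_eqF c0).
have pE : ((r `^ (- 2%:R) - 1) `^ (- beta) * r `^ (- d%:R - 1) =
    r `^ (2 * beta - d%:R - 1) / (1 - r ^+ 2) `^ beta)%R.
  have r2 : (r ^+ 2 < 1)%R by rewrite exprn_ilt1// ltW.
  have -> : (r `^ (- 2%:R) - 1 = (1 - r ^+ 2) * r `^ (- 2%:R))%R.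
    by rewrite mulrBl mul1r -(powR_mulrn 2 (ltW r0)) -powRD ?subrr ?powRr0//
      (gt_eqF r0) implybT.
  rewrite powRM ?powR_ge0 ?subr_ge0 ?(ltW r2)// -powRrM powRN mulrNN -mulrA -powRD.
    by rewrite mulrC !addrA.
  by rewrite (gt_eqF r0) implybT.
by rewrite aE -pE; field; rewrite (gt_eqF v0) d0.
Qed.

End polar_intensity.

(** * Constraint sets and rational boxes *)

Section constraint_sets.
Context {R : realType} {d : nat}.
Implicit Types (S : set (R * 'rV[R]_d)) (x : 'rV[R]_d) (K : set 'rV[R]_d).

Definition constraint_set S : set 'rV[R]_d :=
  [set x | forall p, S p -> dot x p.2 <= p.1].

(** A rational centre for (t, v) and an index for the radius. Countability is what reduces hitting
    events to countable unions. *)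
Definition code : Type := (rat * 'rV[rat]_d * nat)%type.

HB.instance Definition _ := Countable.on code.

Definition box_radius (c : code) : R := c.2.+1%:R^-1.

Definition box1 (c : code) : set (measurableTypeR R) :=
  [set t | `|t - ratr c.1.1| < box_radius c].

Definition box2 (c : code) : set 'rV[R]_d :=
  [set v | forall i, `|v 0 i - ratr (c.1.2 0 i)| < box_radius c].

Definition box (c : code) : set (R * 'rV[R]_d) := box1 c `*` box2 c.

Definition hits S (c : code) : Prop := S `&` box c !=set0.

(** Quantifying over all [S] makes this a deterministic property of the list and [K]; randomness
    enters only through the boxes that are hit. *)
Definition excludes K (l : seq code) : Prop :=
  forall S, (forall c, c \in l -> hits S c) -> constraint_set S `&` K = set0.

Lemma measurable_box1 c : measurable (box1 c).
Proof.
rewrite (_ : box1 c = ball (ratr c.1.1 : R) (box_radius c)).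
  exact: measurable_ball.
by apply/seteqP; split => t; rewrite /box1 /ball/= distrC.
Qed.

Lemma measurable_box2 c : measurable (box2 c).
Proof.
rewrite (_ : box2 c = \bigcap_(i in [set: 'I_d])
    (rV_coord i @^-1` ball (ratr (c.1.2 0 i) : R) (box_radius c))).
  apply: fin_bigcap_measurable => // i _.
  rewrite -[X in measurable X]setTI; apply: measurable_rV_coord => //.
  exact: measurable_ball.
apply/seteqP; split => v vc i => [_|]; rewrite /ball/= distrC; first exact: vc.
by rewrite distrC; have := vc i I; rewrite /ball/= distrC.
Qed.

Let l1 x : R := \sum_i `|x 0 i|.

Let l1_ge0 x : 0 <= l1 x.
Proof. exact: sumr_ge0. Qed.

Lemma dist_dot x (v w : 'rV[R]_d) (e : R) : (forall i, `|v 0 i - w 0 i| < e) ->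
  `|dot x v - dot x w| <= e * l1 x.
Proof.
move=> vw; rewrite /dot -sumrB (le_trans (ler_norm_sum _ _ _))// /l1 mulr_sumr.
apply: ler_sum => i _; rewrite -mulrBr normrM mulrC ler_wpM2r//.
by rewrite ltW.
Qed.

Let center2 (c : code) : 'rV[R]_d := map_mx ratr c.1.2.

(* [box_radius c * (1 + l1 x)] bounds the variation of [dot x p.2 - p.1] over
   [box c]; this makes the set explicitly open. *)
Let violating (c : code) : set 'rV[R]_d :=
  [set x | 0 < dot x (center2 c) - ratr c.1.1 - box_radius c * (1 + l1 x)].

Let violatingP c x p : violating c x -> box c p -> p.1 < dot x p.2.
Proof.
rewrite /violating/= => xc [/= p1 p2].
have : `|dot x p.2 - dot x (center2 c)| <= box_radius c * l1 x.
  by apply: dist_dot => i; rewrite mxE; exact: p2.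
rewrite ler_norml => /andP[h _].
move: p1 xc; rewrite /box1/= ltr_norml mulrDr mulr1 => /andP[_ h1] h2.
lra.
Qed.

Let violating_open c : open (violating c).
Proof.
have cl1 : continuous l1.
  apply: (@continuous_big R _ +%R); first exact: add_continuous.
  move=> i _ x.
  exact: continuous_comp (@coord_continuous _ _ _ _ _ x) (@norm_continuous _ _ _).
have c1 : continuous (fun x => dot x (center2 c) - ratr c.1.1).
  move=> x; exact: (@continuousB _ _ _ (fun x => dot x (center2 c)) (cst _) x
    (@continuous_dot _ _ _ x) (@cst_continuous _ _ _ x)).
have c2 : continuous (fun x => 1 + l1 x).
  move=> x; exact: (@continuousD R R^o _ (cst (1 : R)) l1 x
    (@cst_continuous _ _ _ x) (@cl1 x)).
have c3 : continuous (fun x => box_radius c * (1 + l1 x)).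
  move=> x; exact: (@continuousM _ _ (cst _) (fun x => 1 + l1 x) x
    (@cst_continuous _ _ _ x) (@c2 x)).
apply: (@open_comp _ _ (fun x => dot x (center2 c) - ratr c.1.1 -
  box_radius c * (1 + l1 x)) _ _ (@open_gt R 0)) => x _.
exact: (@continuousB _ _ _ _ _ x (@c1 x) (@c3 x)).
Qed.

Let violating_ex x p : p.1 < dot x p.2 -> exists2 c, violating c x & box c p.
Proof.
move=> px; pose m := dot x p.2 - p.1.
have m0 : 0 < m by rewrite subr_gt0.
have k0 : 0 < 2 * (1 + l1 x) by rewrite mulr_gt0// ltr_wpDr.
(* The margin [m] must cover two errors of size e (1 + l1 x): moving from [p] to the rational centre
   of the box, and the slack that [violating] demands. *)
pose n := Num.bound (m / (2 * (1 + l1 x)))^-1.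
pose e : R := n.+1%:R^-1.
have e0 : 0 < e by rewrite invr_gt0.
have em : e * (2 * (1 + l1 x)) < m.
  rewrite -ltr_pdivlMr// -[ltRHS]invrK ltf_pV2 ?posrE ?invr_gt0 ?divr_gt0//.
  by rewrite (lt_trans (archi_boundP _)) ?invr_ge0 ?divr_ge0 ?ltW// ltr_nat.
have ratE (a : R) : {q : rat | `|a - ratr q| < e}.
  apply: cid; have /rat_in_itvoo[q] : a - e < a + e by rewrite ltrD2l gtrN.
  by rewrite in_itv/= => qa; exists q; rewrite distrC ltr_distl.
pose c : code := (sval (ratE p.1), \row_i sval (ratE (p.2 0 i)), n).
have pc : box c p.
  split; first exact: (svalP (ratE p.1)).
  by move=> i; rewrite mxE; exact: (svalP (ratE (p.2 0 i))).
exists c => //; rewrite /violating/=.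
have : `|dot x p.2 - dot x (center2 c)| <= e * l1 x.
  by apply: dist_dot => i; rewrite mxE; exact: pc.2.
have := pc.1; rewrite /box1/= /box_radius -/e ltr_norml ler_norml.
by move=> /andP[? ?] /andP[? ?]; move: em; rewrite /m mulrDr mulr1 mulrDr => ?; nra.
Qed.

Lemma violating_box x p : p.1 < dot x p.2 ->
  exists2 c, box c p & forall p', box c p' -> p'.1 < dot x p'.2.
Proof. by move=> /violating_ex[c xc pc]; exists c => // p'; exact: violatingP. Qed.

(** If [K] is missed, each of its points strictly violates a constraint in [S], hence lies in the
    open set [violating c] for some box that [S] hits. A finite subcover gives [l], and any other
    set hitting the boxes of [l] rules out the same points. *)
Lemma constraint_set_compactP S K : compact K ->
  constraint_set S `&` K = set0 <->
  exists l, excludes K l /\ forall c, c \in l -> hits S c.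
Proof.
move=> cK; split => [SK0|[l [lK Sl]]]; last exact: lK.
move: cK; rewrite compact_cover => cK.
have [] := cK code (hits S) violating.
- by move=> c _; exact: violating_open.
- move=> x Kx; apply: contrapT => xU.
  suff : (constraint_set S `&` K) x by rewrite SK0.
  split => // p Sp; rewrite leNgt; apply/negP => /violating_ex[c xc pc].
  by apply: xU; exists c => //; exists p.
move=> D' D'S KD'; exists (finmap.enum_fset D'); split; last first.
  by move=> c cD'; have := D'S c cD'; rewrite inE.
move=> S' S'D'; rewrite -subset0 => x [xS' /KD'[c /= cD' xc]].
have [p [Sp pc]] := S'D' c cD'.
by have := xS' p Sp; rewrite leNgt (violatingP xc pc).
Qed.

End constraint_sets.
Arguments code : clear implicits.

(** * Laws determined by the missed boxes *)

Section law_from_hits.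
Local Open Scope ereal_scope.
Context {R : realType} {d : nat}.
Local Notation config := (set (R * 'rV[R]_d)).

Definition hits_sets : set (set config) :=
  range (fun c : code d => [set S : config | hits S c]).

(** Void events rather than hitting events: concatenating lists makes them a pi-system, and their
    probabilities are the explicit ones. *)
Definition misses_sets : set (set config) :=
  range (fun l : seq (code d) => [set S : config | forall c, c \in l -> ~ hits S c]).

Lemma misses_setsI : setI_closed misses_sets.
Proof.
move=> _ _ [l _ <-] [m _ <-]; exists (l ++ m) => //.
apply/seteqP; split => S /=.
  by move=> lm; split => c cl; apply: lm; rewrite mem_cat cl ?orbT.
by move=> [Sl Sm] c; rewrite mem_cat => /orP[/Sl|/Sm].
Qed.

Lemma hits_misses_sigma : <<s hits_sets >> `<=` <<s misses_sets >>.
Proof.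
apply: smallest_sub; first exact: smallest_sigma_algebra.
move=> _ [c _ <-].
rewrite (_ : [set S | _] = setT `\` [set S : config | forall c',
  c' \in [:: c] -> ~ hits S c']).
  apply: sigma_algebraCD.
  by apply: sub_sigma_algebra; exists [:: c].
apply/seteqP; split => S /=.
  by move=> Sc; split => // /(_ c); rewrite inE eqxx => /(_ isT).
by move=> [_ Sc]; apply: contrapT => nSc; apply: Sc => c'; rewrite inE => /eqP ->.
Qed.

(** [B] accounts for the ball in the zero cell and is [setT] for the dual set. Since it is closed,
    its intersection with [K] is compact, and [constraint_set_compactP] expresses missing that
    intersection as a countable union over lists. *)
Lemma hits_sigma_constraint_set (B : set 'rV[R]_d) (A : set (set 'rV[R]_d)) :
  closed B -> hitting_sigma_algebra A ->
  <<s hits_sets >> ((fun S : config => constraint_set S `&` B) @^-1` A).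
Proof.
move=> cB hA.
pose G : set (set (set 'rV[R]_d)) :=
  [set A | <<s hits_sets >> ((fun S : config => constraint_set S `&` B) @^-1` A)].
have [s0 sC sU] : sigma_algebra setT <<s hits_sets >> by exact: smallest_sigma_algebra.
suff : hitting_sigma_algebra `<=` G by apply.
apply: smallest_sub; first split.
- by rewrite /G/= preimage_set0.
- move=> C GC; rewrite /G/= setTD -preimage_setC -setTD; exact: sC.
- by move=> F GF; rewrite /G/= preimage_bigcup; exact: sU.
move=> _ [K cK <-]; rewrite /G/=.
rewrite (_ : _ @^-1` _ = setT `\` [set S : config | constraint_set S `&` (B `&` K)
  = set0]); last first.
  apply/seteqP; split => S /=; rewrite -setIA.
    by move=> /set0P/eqP.
  by move=> [_ /eqP/set0P].
apply: (sC).
have cBK : compact (B `&` K) by rewrite setIC; exact: compact_closedI.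
pose H (o : option (seq (code d))) := if o is Some l
  then [set S : config | excludes (B `&` K) l /\ forall c, c \in l -> hits S c]
  else set0.
rewrite (_ : [set S | _] = \bigcup_n H (unpickle n)); last first.
  apply/seteqP; split => [S /(constraint_set_compactP _ cBK)[l lS]|S [n _]].
    by exists (pickle l) => //; rewrite pickleK.
  rewrite /H; case: (unpickle n) => // l lS.
  by apply/(constraint_set_compactP _ cBK); exists l.
apply: (sU) => n; rewrite /H; case: (unpickle n) => [l|//].
have [lBK|lBK] := pselect (excludes (B `&` K) l); last first.
  by rewrite (_ : [set S | _] = set0)//; apply/seteqP; split => S // -[].
(* Only complements and countable unions are at hand in a generated sigma-algebra, so the finite
   intersection over [l] becomes the complement of a union over indices; the triple of zeros is the
   default of [nth]. *)
rewrite (_ : [set S | _] = setT `\` \bigcup_n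
    (if (n < size l)%N then setT `\` [set S : config | hits S (nth ((0%R, 0%R,
      0%N) : code d) l n)] else set0)); last first.
  apply/seteqP; split => S /=.
    move=> [_ Sl]; split => // -[k _]; case: ifP => // kl [_]; apply; apply: Sl.
    exact: mem_nth.
  move=> [_ Sl]; split => // c cl; apply: contrapT => Sc; apply: Sl.
  by exists (index c l) => //; rewrite index_mem cl nth_index.
apply: (sC); apply: (sU) => k; case: ifP => // kl; apply: (sC).
by apply: sub_sigma_algebra; exists (nth ((0%R, 0%R, 0%N) : code d) l k).
Qed.

Context {d1 d2} {Omega1 : measurableType d1} {Omega2 : measurableType d2}.
Variables (P1 : probability Omega1 R) (P2 : probability Omega2 R).
Variables (S1 : Omega1 -> config) (S2 : Omega2 -> config).

Lemma hits_sigma_measurable : (forall c, measurable [set w | hits (S1 w) c]) ->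
  forall D, <<s hits_sets >> D -> measurable (S1 @^-1` D).
Proof.
move=> mS D hD; pose G : set (set config) := [set D | measurable (S1 @^-1` D)].
suff : <<s hits_sets >> `<=` G by apply.
apply: smallest_sub; first split.
- by rewrite /G/= preimage_set0.
- by move=> C GC; rewrite /G/= setTD -preimage_setC; exact: measurableC.
- by move=> F GF; rewrite /G/= preimage_bigcup; apply: bigcup_measurable => k _;
    exact: GF.
by move=> _ [c _ <-]; exact: mS.
Qed.

(** Measurability of both preimages is part of the induction, as the steps for complements and
    disjoint unions rely on it. *)
Lemma hits_sigma_same_probability :
  (forall l : seq (code d), let M := [set S : config | forall c,
    c \in l -> ~ hits S c] in
    [/\ measurable (S1 @^-1` M), measurable (S2 @^-1` M) &
        P1 (S1 @^-1` M) = P2 (S2 @^-1` M)]) ->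
  forall D, <<s hits_sets >> D -> P1 (S1 @^-1` D) = P2 (S2 @^-1` D).
Proof.
move=> missE D /hits_misses_sigma; rewrite -setI_closed_g_dynkin_g_sigma_algebra;
  last first.
  exact: misses_setsI.
pose G : set (set config) := [set D | [/\ measurable (S1 @^-1` D),
  measurable (S2 @^-1` D) & P1 (S1 @^-1` D) = P2 (S2 @^-1` D)]].
suff : <<d misses_sets >> `<=` G by move=> /[apply] -[].
apply: smallest_sub; last by move=> _ [l _ <-]; exact: missE.
split.
- by rewrite /G/= !preimage_setT !probability_setT.
- move=> C [m1 m2 e]; rewrite /G/= -!preimage_setC; split;
    [exact: measurableC|exact: measurableC|].
  by rewrite !probability_setC// e.
- move=> F tF GF; rewrite /G/= !preimage_bigcup; split.
  + by apply: bigcup_measurable => k _; have [] := GF k.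
  + by apply: bigcup_measurable => k _; have [] := GF k.
  + have trivS T (S : T -> config) : trivIset setT (fun k => S @^-1` F k).
      apply/trivIsetP => i j _ _ ij; rewrite -preimage_setI.
      by move/trivIsetP : tF => /(_ _ _ I I ij) ->; rewrite preimage_set0.
    rewrite !measure_bigcup//.
    * by apply: eq_eseriesr => k _; have [] := GF k.
    * by move=> k _; have [] := GF k.
    * by move=> k _; have [] := GF k.
Qed.

End law_from_hits.

(** * Marked Poisson points *)

Section point_counts.
Local Open Scope ereal_scope.
Context {d} {T : measurableType d} {R : realType}.
Implicit Types (x : nat -> T) (B : set T).

(** Spelled like the process in [zero_cell_sequences], so that the Poisson hypothesis applies by
    conversion. *)
Definition point_count x : set T -> \bar R := mseries (fun n => \d_(x n)) 0.

Let dirac_ge0 x B n : 0 <= (\d_(x n) B : \bar R).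
Proof. exact: measure_ge0. Qed.

Lemma point_count_tail x B n : (forall i, (n <= i)%N -> ~ B (x i)) ->
  point_count x B = (\sum_(i < n) (x i \in B))%:R%:E.
Proof.
move=> xB; rewrite /point_count /mseries (nneseries_split 0 n)// add0n.
rewrite [X in _ + X]eseries0 ?adde0; last first.
  by move=> i ni _; rewrite /= diracE memNset//; exact: xB.
by rewrite big_mkord natr_sum -sumEFin; apply: eq_bigr => i _; rewrite /= diracE.
Qed.

Lemma point_count_ge x B n : (\sum_(i < n) (x i \in B))%:R%:E <= point_count x B.
Proof.
apply: le_trans (nneseries_lim_ge n _); last by [].
by rewrite big_mkord natr_sum -sumEFin; apply: lee_sum => i _; rewrite /= diracE.
Qed.

Lemma point_count0 x B : point_count x B = 0 -> forall i, ~ B (x i).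
Proof.
move=> c0 i Bi; have := point_count_ge x B i.+1;
  rewrite c0 lee_fin lern0 big_ord_recr/=.
by rewrite mem_set// addn1.
Qed.

(** Otherwise points of [B] recur beyond every index and some partial sum exceeds [m]. *)
Lemma point_count_fin x B m : point_count x B = m%:R%:E ->
  exists n, forall i, (n <= i)%N -> ~ B (x i).
Proof.
move=> cm; apply: contrapT => /forallNP inf.
have {}inf n : exists2 i, (n <= i)%N & B (x i).
  by have /existsNP[i /not_implyP[ni /contrapT Bi]] := inf n; exists i.
suff [n nm] : exists n, (m < \sum_(i < n) (x i \in B))%N.
  by have := point_count_ge x B n; rewrite cm lee_fin ler_nat leqNgt nm.
elim: m.+1 => [|k [n IH]]; first by exists 0%N.
have [i ni Bi] := inf n; exists i.+1; rewrite big_ord_recr/= mem_set// addn1 ltnS.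
rewrite (leq_trans IH)// -(subnKC ni) big_split_ord/=; exact: leq_addr.
Qed.

End point_counts.

Section finite_partition.
Local Open Scope ereal_scope.
Context d (T : measurableType d) (R : realType) (mu : {measure set T -> \bar R}).

Lemma measure_bigsetU_seq (I : eqType) (s : seq I) (F : I -> set T) :
  uniq s -> (forall i, measurable (F i)) ->
  (forall i j, i != j -> F i `&` F j = set0) ->
  mu (\big[setU/set0]_(i <- s) F i) = \sum_(i <- s) mu (F i).
Proof.
move=> + mF tF; elim: s => [_|i s IH /= /andP[is_ us]]; first by rewrite !big_nil.
rewrite !big_cons measureU//; first by congr (_ + _); exact: IH.
- by apply: bigsetU_measurable.
- rewrite big_distrr/= big_seq big1// => j js; apply: tF.
  by apply: contraNneq is_ => ->.
Qed.


Lemma measure_finite_partition (V : finType) (f : T -> V) (X : set T)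
    (Q : pred V) : measurable X ->
  (forall v, measurable (f @^-1` [set v])) ->
  mu (X `&` [set t | Q (f t)]) = \sum_(v | Q v) mu (X `&` f @^-1` [set v]).
Proof.
move=> mX mf; rewrite -big_filter -measure_bigsetU_seq.
- congr (mu _); rewrite -bigcup_seq; apply/seteqP; split => t /=.
    by move=> [Xt Qt]; exists (f t) => //=; rewrite mem_filter Qt mem_index_enum.
  move=> [v /=]; rewrite mem_filter => /andP[Qv _] [Xt /= tv].
  by split => //=; rewrite tv.
- by rewrite filter_uniq// index_enum_uniq.
- by move=> v; exact: measurableI.
- move=> v w vw; apply/seteqP; split => // t [[_ /= tv] [_ /= tw]].
  by move: vw; rewrite -tv -tw eqxx.
Qed.

End finite_partition.

Section sigma_of_sequence_cylinders.
Context {dO} {Omega : measurableType dO} {dT} {T : measurableType dT}.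

(** The form in which events about all labels, or all marks, enter [independent_sequences]. *)
Lemma sigma_of_sequence_cylinder (X : nat -> Omega -> T) (C : nat -> set T) :
  (forall i, measurable (C i)) ->
  sigma_of_sequence X (\bigcap_i X i @^-1` C i).
Proof.
move=> mC; rewrite -[X in sigma_of_sequence _ X]setCK setC_bigcap -setTD.
apply: sigma_algebraCD; apply: sigma_algebra_bigcup => i.
rewrite -setTD; apply: sigma_algebraCD; apply: sub_sigma_algebra; exists i => //.
by exists (C i) => //; rewrite setTI.
Qed.

End sigma_of_sequence_cylinders.

Section marked_points.
Local Open Scope ereal_scope.
Context {R : realType} {dO} {Omega : measurableType dO} (P : probability Omega R).
Context {dS} {S : measurableType dS} {dT} {T : measurableType dT}.
Variables (r : nat -> Omega -> S) (u : nat -> Omega -> T).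
Hypotheses (mr : forall n, measurable_fun setT (r n))
  (mu : forall n, measurable_fun setT (u n)).
Hypotheses (u_law : forall n B, measurable B ->
    P (u n @^-1` B) = P (u 0%N @^-1` B))
  (u_indep : mutually_independent P u) (ru_indep : independent_sequences P r u).
Variables (k : nat) (lab : S -> option 'I_k) (A : 'I_k -> set T).
Hypotheses (mlab : forall o, measurable (lab @^-1` [set o]))
  (mA : forall j, measurable (A j)).

(** A point labelled [None] lies outside the cells and puts no restriction on its mark. *)
Definition marks_avoid : set Omega :=
  [set w | forall n j, lab (r n w) = Some j -> ~ A j (u n w)].

Let q (j : 'I_k) : R := fine (P (u 0%N @^-1` (~` A j))).

Let qo (o : option 'I_k) : R := if o is Some j then q j else 1%R.

Let Ao (o : option 'I_k) : set T := if o is Some j then ~` A j else setT.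

Let mAo o : measurable (Ao o).
Proof. by case: o => [j|] //=; exact: measurableC. Qed.

Let P_Ao n o : P (u n @^-1` Ao o) = (qo o)%:E.
Proof.
rewrite u_law//; case: o => [j|] /=; last by rewrite preimage_setT probability_setT.
rewrite fineK// fin_num_measure// -[X in measurable X]setTI.
by apply: mu => //; exact: measurableC.
Qed.

Let mlabr n o : measurable [set w | lab (r n w) = o].
Proof. by rewrite -[X in measurable X]setTI; exact: (mr n measurableT (mlab o)). Qed.

Lemma measurable_marks_avoid : measurable marks_avoid.
Proof.
rewrite (_ : marks_avoid = \bigcap_n ~` \bigcup_(j in [set: 'I_k])
    ([set w | lab (r n w) = Some j] `&` u n @^-1` A j)).
  apply: bigcapT_measurable => n; apply: measurableC.
  apply: fin_bigcup_measurable => // j _; apply: measurableI => //.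
  by rewrite -[X in measurable X]setTI; exact: mu.
apply/seteqP; split => w wA n; first by move=> _ [j _ [wj]]; exact: wA wj.
by move=> j wj Aj; apply: (wA n I); exists j.
Qed.

Let labelled (tau : nat -> option 'I_k) : set Omega :=
  \bigcap_n [set w | lab (r n w) = tau n].

(* When no radius beyond the [n]-th has a label, only the first [n] marks matter:
   independence replaces conditioning on the radii. *)
Let labelled_avoid n tau : (forall i, (n <= i)%N -> tau i = None) ->
  P (marks_avoid `&` labelled tau) =
  (\prod_(i < n) qo (tau i))%:E * P (labelled tau).
Proof.
move=> tau_n.
pose U := \bigcap_(i in [set` iota 0 n]) u i @^-1` Ao (tau i).
have UE : U = \bigcap_i u i @^-1` Ao (tau i).
  apply/seteqP; split => w wU i; last by move=> _; exact: wU.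
  move=> _; have [ni|ni] := leqP n i; first by rewrite tau_n.
  by apply: wU; rewrite /= mem_iota add0n.
have -> : marks_avoid `&` labelled tau = labelled tau `&` U.
  rewrite setIC; apply/seteqP; split => w [wt wA]; split => //.
    rewrite UE => i _; rewrite /Ao/=; case tE : (tau i) => [j|//]; apply: wA.
    by rewrite -tE; exact: wt.
  move=> i j; have /= -> := wt i I; move=> tE Aj.
  by move: wA; rewrite UE => /(_ i I); rewrite /= tE; exact.
rewrite ru_indep.
- rewrite muleC; congr (_ * _); rewrite u_indep ?iota_uniq//.
  rewrite -prodEFin -(big_mkord predT (fun i => (qo (tau i))%:E)) /index_iota subn0.
  by apply: eq_bigr => i _; exact: P_Ao.
- exact: (@sigma_of_sequence_cylinder _ _ _ _ r (fun i => lab @^-1` [set tau i])).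
- by rewrite UE; exact: (@sigma_of_sequence_cylinder _ _ _ _ u).
Qed.

Let tail n : set Omega := [set w | forall i, (n <= i)%N -> lab (r i w) = None].

Let mtail n : measurable (tail n).
Proof.
rewrite (_ : tail n = \bigcap_(i in [set i | (n <= i)%N]) [set w | lab (r i w) = None]).
  exact: bigcap_measurableType.
by apply/seteqP; split => w wn i; exact: wn.
Qed.

Let prefix n (w : Omega) : {ffun 'I_n -> option 'I_k} := [ffun i => lab (r (val i) w)].

Let extend n (v : {ffun 'I_n -> option 'I_k}) (i : nat) : option 'I_k :=
  if insub i is Some i' then v i' else None.

Let tail_prefix n v : tail n `&` prefix n @^-1` [set v] = labelled (extend v).
Proof.
apply/seteqP; split => w.
  move=> [wn /= <-] i _ /=; rewrite /extend; case: insubP => [i' _ <-|].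
    by rewrite ffunE.
  by rewrite -leqNgt => /wn.
move=> wl; split => [i ni|].
  by have /= -> := wl i I; rewrite /extend insubF// ltnNge ni.
by apply/ffunP => i; rewrite ffunE; have /= -> := wl i I; rewrite /extend valK.
Qed.

Let mprefix n v : measurable (prefix n @^-1` [set v]).
Proof.
rewrite (_ : _ @^-1` _ = \bigcap_(i in [set: 'I_n]) [set w | lab (r (val i) w) = v i]).
  exact: fin_bigcap_measurable.
apply/seteqP; split => w /=; first by move=> <- i _ /=; rewrite ffunE.
by move=> wv; apply/ffunP => i; rewrite ffunE; exact: (wv i I).
Qed.

Let label_count n (v : {ffun 'I_n -> option 'I_k}) (j : 'I_k) : nat :=
  \sum_(i < n) (v i == Some j).

Let prod_label_count n (v : {ffun 'I_n -> option 'I_k}) :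
  (\prod_(i < n) qo (extend v i) = \prod_j q j ^+ label_count v j)%R.
Proof.
under [RHS]eq_bigr do rewrite -prodrXr.
rewrite exchange_big/=; apply: eq_bigr => i _; rewrite /extend valK.
case: (v i) => [j|]/=; last by rewrite big1.
rewrite (bigD1 j)//= eqxx expr1 big1 ?mulr1// => j' /negPf j'j.
by rewrite (_ : (Some j == Some j') = false)//; apply/eqP => -[/esym/eqP]; rewrite j'j.
Qed.

Local Notation counts j := (fun w => @point_count _ _ R (r ^~ w) (lab @^-1` [set
  Some j])).

Let has_counts (m : 'I_k -> nat) : set Omega :=
  [set w | forall j, counts j w = (m j)%:R%:E].

Variable nu : set S -> \bar R.
Hypotheses (nu_ge0 : forall B, 0 <= nu B)
  (nu_fin : forall j, nu (lab @^-1` [set Some j]) < +oo)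
  (r_poisson : is_poisson_process P nu (fun w => mseries (fun n => \d_(r n w)) 0)).

Let mcounts j : measurable_fun setT (counts j).
Proof. exact (poisson_process_measurable r_poisson (mlab _)). Qed.

Let mhas_counts m : measurable (has_counts m).
Proof.
rewrite (_ : has_counts m = \bigcap_(j in [set: 'I_k]) (counts j @^-1` [set (m
  j)%:R%:E])).
  apply: fin_bigcap_measurable => // j _; rewrite -[X in measurable X]setTI.
  by apply: mcounts => //; exact: emeasurable_set1.
by apply/seteqP; split => w wm j; [move=> _; exact: wm|exact: (wm j I)].
Qed.

Let tail_counts n w j : tail n w ->
  counts j w = (label_count (prefix n w) j)%:R%:E.
Proof.
move=> wn; apply: (etrans (point_count_tail (n := n) _)); last first.
  congr (_%:R%:E); apply: eq_bigr => i _; rewrite ffunE; congr nat_of_bool.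
  by apply/idP/eqP; rewrite inE.
by move=> i ni /=; rewrite wn.
Qed.

Let tail_has_counts n m : tail n `&` has_counts m =
  tail n `&` [set w | [forall j, label_count (prefix n w) j == m j]].
Proof.
apply/seteqP; split => w [wn wm]; split => //=.
  apply/forallP => j; have := wm j; rewrite (tail_counts _ wn) => /eqP.
  by rewrite eqe eqr_nat.
by move=> j; rewrite (tail_counts _ wn); move/forallP : wm => /(_ j)/eqP ->.
Qed.

(** Split according to the first [n] labels. By [prod_label_count] the factor from [labelled_avoid]
    depends on them only through the counts, so it is the same on every piece. *)
Let avoid_tail_counts n m : P (marks_avoid `&` tail n `&` has_counts m) =
  (\prod_j q j ^+ m j)%:E * P (tail n `&` has_counts m).
Proof.
rewrite -setIA tail_has_counts setIA.
have part X mX := measure_finite_partition P (f := prefix n) (X := X)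
  (fun v => [forall j, label_count v j == m j]) mX (@mprefix n).
rewrite part; last by apply: measurableI => //; exact: measurable_marks_avoid.
rewrite part//.
rewrite ge0_sume_distrr//; apply: eq_bigr => v /forallP vm.
have ev i : (n <= i)%N -> extend v i = None.
  by move=> ni; rewrite /extend insubF// ltnNge ni.
transitivity (P (marks_avoid `&` labelled (extend v))).
  by rewrite -setIA tail_prefix.
rewrite (labelled_avoid ev) prod_label_count tail_prefix; congr (_%:E * _).
by apply: eq_bigr => j _; rewrite (eqP (vm j)).
Qed.

Let has_counts_tail m : has_counts m `<=` \bigcup_n tail n.
Proof.
move=> w wm.
have /choice[N NE] j : exists n, forall i, (n <= i)%N -> lab (r i w) <> Some j.
  exact: point_count_fin (wm j).
exists (\max_j N j)%N => // i Ni; case E: (lab (r i w)) => [j|//].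
by exfalso; apply: NE E; apply: leq_trans Ni; exact: leq_bigmax.
Qed.

(** When the counts are finite only finitely many points are labelled, so the events [tail n]
    exhaust [has_counts m], and the factor survives the limit. *)
Lemma marks_avoid_counts m : P (marks_avoid `&` has_counts m) =
  (\prod_j q j ^+ m j)%:E * P (has_counts m).
Proof.
have cvg_tail X : measurable X ->
    P (tail n `&` has_counts m `&` X) @[n --> \oo] --> P (has_counts m `&` X).
  move=> mX; have -> : has_counts m `&` X = \bigcup_n (tail n `&` has_counts m `&` X).
    apply/seteqP; split => [w [wm Xw]|w [n _ [[]]]//].
    by have [n _ wn] := has_counts_tail wm; exists n.
  have mt n : measurable (tail n `&` has_counts m `&` X).
    by do 2 apply: measurableI => //.
  apply: nondecreasing_cvg_mu => //; first exact: bigcupT_measurable.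
  move=> a b ab; apply/subsetPset; apply: setSI; apply: setSI => w wa i bi.
  by apply: wa; exact: leq_trans bi.
have c1 := cvg_tail _ measurable_marks_avoid.
have /cvg_tail : measurable [set: Omega] by [].
under eq_fun do rewrite setIT; rewrite setIT => c2.
rewrite setIC; apply: (@cvg_unique _ _ (P (tail n `&` has_counts m `&` marks_avoid)
  @[n --> \oo])) => //.
have e n : P (tail n `&` has_counts m `&` marks_avoid) =
    (\prod_j q j ^+ m j)%:E * P (tail n `&` has_counts m).
  by rewrite setIC setIA avoid_tail_counts.
rewrite (_ : (fun n => _) =
    (fun n => (\prod_j q j ^+ m j)%:E * P (tail n `&` has_counts m))).
  exact: cvgeMl.
by apply/funext => n; exact: e.
Qed.

Let F (j : 'I_k) : R := fine (nu (lab @^-1` [set Some j])).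

Let pmf (j : 'I_k) (i : nat) : R := (F j ^+ i / i`!%:R * expR (- F j))%R.

Let F_ge0 j : (0 <= F j)%R.
Proof. exact: fine_ge0. Qed.

Let P_counts j i : P [set w | counts j w = i%:R%:E] = (pmf j i)%:E.
Proof.
have := @poisson_process_law _ _ _ _ _ _ _ _ r_poisson (lab @^-1` [set Some j]) i
  (mlab _) (nu_fin j).
move=> e; transitivity (poisson_prob (F j) 0%N [set i]); first exact: e.
(* At rate 0 [poisson_prob] is the Dirac mass at 0, with which [pmf] agrees since [0 ^+ 0 = 1]. *)
rewrite /poisson_prob -/(F j); case: ltP => Fj.
  by rewrite esum_set1 ?lee_fin ?poisson_pmf_ge0// /poisson_pmf Fj.
have F0 : F j = 0%R by apply/eqP; rewrite eq_le Fj F_ge0.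
rewrite /pmf F0 oppr0 expR0 mulr1 diracE; case: i {e} => [|i].
  by rewrite mem_set// expr0 divr1.
by rewrite memNset// expr0n/= mul0r.
Qed.

Let P_has_counts m : P (has_counts m) = (\prod_j pmf j (m j))%:E.
Proof.
have tB : trivIset setT (fun j : 'I_k => lab @^-1` [set Some j]).
  by apply/trivIsetP => i j _ _ ij; apply/seteqP; split => // s [/= -> [/eqP]];
    rewrite (negPf ij).
have := @poisson_process_independent _ _ _ _ _ _ _ _ r_poisson k _ (fun j =>
  mlab (Some j)) tB
  (index_enum 'I_k) (fun j => [set (m j)%:R%:E]) (index_enum_uniq _) (fun j =>
    emeasurable_set1 _).
rewrite -prodEFin => e.
transitivity (\prod_(j <- index_enum 'I_k) P [set w | counts j w = (m j)%:R%:E]).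
  rewrite -[RHS]e; congr (P _); apply/seteqP; split => w wm j; first by move=> _;
    exact: (wm j).
  by have := wm j; rewrite /= mem_index_enum; exact.
by apply: eq_bigr => j _; rewrite P_counts.
Qed.

Definition finite_counts : set Omega :=
  [set w | forall j, exists m, counts j w = m%:R%:E].

Let few M : set Omega := \bigcup_(v in [set: {ffun 'I_k -> 'I_M}]) has_counts (val
  \o v).

Let mfew M : measurable (few M).
Proof. exact: fin_bigcup_measurable. Qed.

Let few_nd : nondecreasing_seq few.
Proof.
move=> M M' MM'; apply/subsetPset => w [v _ wv].
by exists [ffun j => widen_ord MM' (v j)] => // j; rewrite /= ffunE; exact: wv.
Qed.

Let few_finite : \bigcup_M few M = finite_counts.
Proof.
apply/seteqP; split => [w [M _ [v _ wv]] j|w wf]; first by exists (v j); exact: wv.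
have [m mE] := choice wf; pose M := (\max_j m j).+1.
have mM j : (m j < M)%N by rewrite ltnS; exact: leq_bigmax.
by exists M => //; exists [ffun j => Ordinal (mM j)] => // j; rewrite /= ffunE;
  exact: mE.
Qed.

(** Only finitely many count vectors lie below [M]; [bigA_distr_bigA] turns the sum over them of
    products into a product of partial sums, one for each label. *)
Let avoid_few M : P (marks_avoid `&` few M) =
  (\prod_j \sum_(i < M) (q j ^+ i * pmf j i))%:E.
Proof.
have -> : marks_avoid `&` few M =
    \big[setU/set0]_(v : {ffun 'I_k -> 'I_M}) (marks_avoid `&` has_counts (val \o v)).
  rewrite /few setI_bigcupr -bigcup_seq; apply/seteqP; split => w [v _ wv];
  by exists v => //=; exact: mem_index_enum.
rewrite measure_bigsetU_seq ?index_enum_uniq//; last 2 first.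
- by move=> v; apply: measurableI => //; exact: measurable_marks_avoid.
- move=> v v' /eqP vv'; apply/seteqP; split => // w [[_ wv] [_ wv']]; apply: vv'.
  apply/ffunP => j; apply/val_inj/eqP; rewrite -(eqr_nat R) -eqe.
  by apply/eqP; apply: (etrans (esym (wv j))); exact: wv'.
rewrite bigA_distr_bigA/= -sumEFin; apply: eq_bigr => v _.
by rewrite marks_avoid_counts P_has_counts -EFinM -big_split.
Qed.

(** The generating function of the Poisson law, evaluated at [q j]. *)
Let pmf_sum j : (\sum_(i < M) (q j ^+ i * pmf j i))%R @[M --> \oo] -->
  expR (- (F j * (1 - q j))).
Proof.
rewrite mulrBr mulr1 opprB addrC expRD.
rewrite (_ : (fun M => _) =
    (fun M => expR (- F j) * series (exp_coeff (F j * q j)) M)%R).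
  by apply: cvgMr; exact: is_cvg_series_exp_coeff.
apply/funext => M; rewrite /series/= mulr_sumr big_mkord; apply: eq_bigr => i _.
by rewrite /pmf /exp_coeff/= exprMn; ring.
Qed.

Lemma marks_avoid_finite_counts : P (marks_avoid `&` finite_counts) =
  (\prod_j expR (- (F j * (1 - q j))))%:E.
Proof.
have c1 : P (marks_avoid `&` few M) @[M --> \oo] --> P (marks_avoid `&` finite_counts).
  rewrite -few_finite setI_bigcupr.
  have mf M : measurable (marks_avoid `&` few M).
    by apply: measurableI => //; exact: measurable_marks_avoid.
  apply: nondecreasing_cvg_mu => //; first exact: bigcupT_measurable.
  by move=> a b ab; apply/subsetPset; apply: setIS; apply/subsetPset; exact: few_nd.
apply: (@cvg_unique _ _ (P (marks_avoid `&` few M) @[M --> \oo])) => //.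
rewrite (_ : (fun M => _) =
  EFin \o (fun M => \prod_j \sum_(i < M) (q j ^+ i * pmf j i))%R); last first.
  by apply/funext => M; exact: avoid_few.
apply/fine_cvgP; split; first by near=> M.
apply: (@cvg_big R _ ( *%R) 1%R predT (@mul_continuous R)) => j _.
exact: pmf_sum.
Unshelve. all: by end_near. Qed.

End marked_points.

Lemma probability_setI1 {R : realType} {d} {T : measurableType d}
    (P : probability T R) (N X : set T) :
  measurable N -> measurable X -> P N = 1%E -> P (X `&` N) = P X.
Proof.
move=> mN mX PN; rewrite [RHS](measureDI P mX mN).
rewrite [X in (X + _)%E](_ : _ = 0%E) ?add0e//.
apply/eqP; rewrite eq_le measure_ge0 andbT.
apply: (@le_trans _ _ (P (~` N))); last by rewrite probability_setC// PN subee.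
apply: le_measure; rewrite ?inE; [exact: measurableD|exact: measurableC|].
exact: subDsetr.
Qed.

Section marked_poisson_void.
Local Open Scope ereal_scope.
Context {R : realType} {dO} {Omega : measurableType dO} (P : probability Omega R).
Context {dS} {S : measurableType dS} {dT} {T : measurableType dT}.
Variables (r : nat -> Omega -> S) (u : nat -> Omega -> T) (nu : set S -> \bar R).
Hypotheses (mr : forall n, measurable_fun setT (r n))
  (mu : forall n, measurable_fun setT (u n)).
Hypotheses (u_law : forall n B, measurable B ->
    P (u n @^-1` B) = P (u 0%N @^-1` B))
  (u_indep : mutually_independent P u) (ru_indep : independent_sequences P r u).
Hypotheses (nu_ge0 : forall B, 0 <= nu B)
  (r_poisson : is_poisson_process P nu (fun w => mseries (fun n => \d_(r n w)) 0)).

(** The exponent is minus the mass of the forbidden pairs under the product of [nu] and the law of a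
    mark, as for a marked Poisson process. *)
Lemma marks_avoid_void (k : nat) (lab : S -> option 'I_k) (A : 'I_k -> set T) :
  (forall o, measurable (lab @^-1` [set o])) ->
  (forall j, measurable (A j)) ->
  (forall j, nu (lab @^-1` [set Some j]) < +oo) ->
  P (marks_avoid r u lab A) =
  (expR (- \sum_j fine (nu (lab @^-1` [set Some j])) * fine (P (u 0%N @^-1` A j))))%:E.
Proof.
move=> mlab mA nu_fin.
have mpre B : measurable B -> measurable (u 0%N @^-1` B).
  by move=> mB; rewrite -[X in measurable X]setTI; exact: mu.
pose N := finite_counts (R := R) r lab.
have mcounts j : measurable_fun setT
    (fun w => @point_count _ _ R (r ^~ w) (lab @^-1` [set Some j])).
  exact (poisson_process_measurable r_poisson (mlab _)).
have mN : measurable N.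
  rewrite (_ : N = \bigcap_(j in [set: 'I_k]) \bigcup_m
      ((fun w => @point_count _ _ R (r ^~ w) (lab @^-1` [set Some j])) @^-1` [set
        m%:R%:E])).
    apply: fin_bigcap_measurable => // j _; apply: bigcup_measurable => m _.
    rewrite -[X in measurable X]setTI.
    exact: (mcounts j measurableT _ (emeasurable_set1 _)).
  apply/seteqP; split => [w wN j _|w wN j].
    by have [m wm] := wN j; exists m.
  by have [m _ wm] := wN j I; exists m.
have PN : P N = 1.
  (* With no forbidden mark, the formula gives the total mass. *)
  have := marks_avoid_finite_counts mr mu u_law u_indep ru_indep mlab
    (fun j : 'I_k => @measurable0 _ T) nu_ge0 nu_fin r_poisson.
  rewrite (_ : marks_avoid _ _ _ _ = setT) ?setTI; last by apply/seteqP; split =>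
    // w _ n j _ [].
  move=> ->; rewrite big1// => j _.
  by rewrite setC0 preimage_setT probability_setT subrr mulr0 oppr0 expR0.
have mav := measurable_marks_avoid mr mu mlab mA.
rewrite -(probability_setI1 mN mav PN).
rewrite (marks_avoid_finite_counts mr mu u_law u_indep ru_indep mlab mA
  nu_ge0 nu_fin r_poisson).
congr EFin; rewrite -expR_sum -sumrN; congr expR; apply: eq_bigr => j _.
rewrite -preimage_setC probability_setC; last exact: mpre.
rewrite fineB ?fin_num_measure//; last exact: mpre.
by rewrite opprB addrC subrK.
Qed.

End marked_poisson_void.

(** * Zero cells and dual sets as constraint sets *)

Section constraint_geometry.
Context {R : realType} {d : nat}.
Implicit Types (S : set (R * 'rV[R]_d)) (x y v : 'rV[R]_d).

Lemma constraint_setU S S' :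
  constraint_set (S `|` S') = constraint_set S `&` constraint_set S'.
Proof.
apply/seteqP; split => x.
  by move=> xS; split => p Sp; apply: xS; [left|right].
by move=> [xS xS'] p [/xS|/xS'].
Qed.

Lemma closed_constraint_set S : closed (constraint_set S).
Proof.
rewrite (_ : constraint_set S =
    \bigcap_(p in S) ((fun x => dot x p.2) @^-1` [set t | t <= p.1])).
  apply: closed_bigI => p _; apply: preimage_closed; last exact: closed_le.
  by move=> x _; exact: continuous_dot.
by apply/seteqP; split => x xS p; exact: xS.
Qed.

Lemma convex_constraint_set S : convex_set (constraint_set S).
Proof.
move=> x y l /set_mem xS /set_mem yS; apply/mem_set => p Sp.
rewrite -[X in dot X _]/(l%:num *: x + (1 - l%:num) *: y) dotDl !dotZl.
rewrite -[leRHS]mul1r -[X in _ <= X * _](subrKC l%:num) [leRHS]mulrDl.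
by apply: lerD; apply: ler_wpM2l; rewrite ?subr_ge0 ?xS ?yS.
Qed.

(** Expand |x - y|^2 >= 0. *)
Lemma dot_le1 x y : enorm x <= 1 -> enorm y <= 1 -> dot x y <= 1.
Proof.
move=> x1 y1; have := dotxx_ge0 (x + (-1) *: y).
rewrite !(dotDl, dotDr, dotZl, dotZr) -!sqr_enorm [dot y x]dotC => h.
have x2 : enorm x ^+ 2 <= 1 by rewrite expr_le1 ?enorm_ge0.
have y2 : enorm y ^+ 2 <= 1 by rewrite expr_le1 ?enorm_ge0.
lra.
Qed.

Lemma dot_direction x y : dot x (direction y) = (enorm y)^-1 * dot x y.
Proof. exact: dotZr. Qed.

(** The ball is its own dual. As a constraint set it inherits closedness and convexity from the
    general lemmas. *)
Definition ball_constraints : set (R * 'rV[R]_d) :=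
  [set p | p.1 = 1 /\ enorm p.2 <= 1].

Lemma closed_ball1E : @closed_ball1 R d = constraint_set ball_constraints.
Proof.
apply/seteqP; split => x; rewrite /closed_ball1/=.
  by move=> x1 [t v] [/= -> v1]; exact: dot_le1.
move=> xB; rewrite leNgt; apply/negP => x1.
have x0 : x != 0 by rewrite -enorm_gt0 (lt_trans _ x1).
have /= := xB (1, direction x) (conj erefl _).
rewrite enorm_direction// => /(_ (lexx _)).
rewrite dot_direction -sqr_enorm expr2 mulKf ?enorm_eq0//.
by rewrite leNgt x1.
Qed.

Definition zero_cell_constraints (r : nat -> R) (u : nat -> 'rV[R]_d) :
    set (R * 'rV[R]_d) := range (fun n => (r n, u n)).

Lemma zero_cellE r u : zero_cell r u =
  constraint_set (zero_cell_constraints r u) `&` @closed_ball1 R d.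
Proof.
apply/seteqP; split => x [xb xr]; split => //; first by move=> _ [n _ <-]; exact: xr.
by move=> n; apply: (xb (r n, u n)); exists n.
Qed.

(* [y = 0] would only give the trivial constraint [0 <= 1]. *)
Definition dual_constraints (Y : set 'rV[R]_d) : set (R * 'rV[R]_d) :=
  [set ((enorm y)^-1, direction y) | y in Y `&` [set y | y != 0]].

(** Dividing <x, y> <= 1 by |y| gives the constraint of [y]. The half-space {y : <y, x> <= 1} is
    closed and convex, so it contains the hull as soon as it contains the points. *)
Lemma convex_dual_hullE (Y : set 'rV[R]_d) :
  convex_dual (closed_convex_hull Y) = constraint_set (dual_constraints Y).
Proof.
apply/seteqP; split => x.
  move=> xY _ [y [Yy /= y0] <-]/=; rewrite dot_direction.
  rewrite -[leRHS]mulr1 ler_wpM2l ?invr_ge0 ?enorm_ge0//; apply: xY.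
  exact: sub_gen_smallest.
move=> xY y Yy; have : [set y | dot y x <= 1] y; last by rewrite /= dotC.
apply: Yy; split.
  split.
    have -> : [set y | dot y x <= 1] = constraint_set [set (1, x)].
      by apply/seteqP; split => z zx; [move=> _ ->|exact: (zx (1, x))].
    exact: closed_constraint_set.
  have -> : [set y | dot y x <= 1] = constraint_set [set (1, x)].
    by apply/seteqP; split => z zx; [move=> _ ->|exact: (zx (1, x))].
  exact: convex_constraint_set.
move=> z Yz /=; have [->|z0] := eqVneq z 0; first by rewrite dotC dot0r.
have /= : dot x (direction z) <= (enorm z)^-1.
  by apply: (xY ((enorm z)^-1, direction z)); exists z.
rewrite dot_direction dotC -[leRHS]mulr1 ler_pM2l// invr_gt0 enorm_gt0//.
Qed.

End constraint_geometry.

(** * Null sets of counting measures *)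

Section counting_atoms.
Local Open Scope ereal_scope.
Context {dT} {T : measurableType dT} {R : realType}.

Lemma counting_eq0 (X : set nat) : counting X = 0 :> \bar R -> X = set0.
Proof.
rewrite /counting; case: asboolP => // fX /eqP.
rewrite eqe pnatr_eq0 finmap.cardfs_eq0 => /eqP X0.
by rewrite -(fset_setK fX) X0 set_fset0.
Qed.

(** General measures may charge a set without atoms; here every point listed by the counting
    representation is itself an atom. *)
Lemma counting_measure_eq0 (m : set T -> \bar R) (B : set T) :
  is_counting_measure m -> (forall x : T, measurable [set x]) -> measurable B ->
  m B = 0 <-> forall y, atoms m y -> ~ B y.
Proof.
move=> [D [x mE]] m1 mB; split => [|noB].
  rewrite mE// => /counting_eq0 DB y; rewrite /atoms/= mE// => y0 By.
  have [n [Dn /= xy]] : exists n, (D `&` x @^-1` [set y]) n.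
    apply/set0P; apply: contraTneq y0 => ->.
    by rewrite -[counting set0]/(counting (set0 : set nat)) measure0 ltxx.
  suff : (D `&` x @^-1` B) n by rewrite DB.
  by split => //=; rewrite xy.
rewrite mE// (_ : D `&` _ = set0) ?measure0//; apply/seteqP; split => // n [Dn Bn].
apply: (noB (x n)) => //; rewrite /atoms/= mE//.
rewrite lt_neqAle measure_ge0 andbT eq_sym; apply/eqP => /counting_eq0 e.
by have : (D `&` x @^-1` [set x n]) n by []; rewrite e.
Qed.

End counting_atoms.

(** * Positive mass of boxes that meet the sphere *)

Section cubes.
Context {R : realType}.

Definition cube n (a : 'rV[R]_n) (e : R) : set 'rV[R]_n :=
  [set v | forall i, ball (a 0 i) e (v 0 i)].

Lemma measurable_cube n (a : 'rV[R]_n) e : measurable (cube a e).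
Proof.
rewrite (_ : cube a e = \bigcap_(i in [set: 'I_n]) (rV_coord i @^-1` ball (a 0 i) e)).
  apply: fin_bigcap_measurable => // i _.
  rewrite -[X in measurable X]setTI; apply: measurable_rV_coord => //.
  exact: measurable_ball.
by apply/seteqP; split => v va i; [move=> _; exact: va|exact: (va i I)].
Qed.

Lemma lebesgue_rV_cube n (a : 'rV[R]_n) e : 0 <= e ->
  lebesgue_rV n (cube a e) = ((e *+ 2) ^+ n)%:E.
Proof.
move=> e0; elim: n a => [|n IH] a.
  by rewrite /= diracE mem_set// => -[].
rewrite /= /cons_measure /pushforward.
rewrite (_ : _ @^-1` _ = ball (a 0 ord0) e `*` cube (rV_uncons a).2 e).
  rewrite product_measure1E//=; last 2 first.
  - exact: measurable_ball.
  - exact: measurable_cube.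
  by rewrite exprS EFinM; congr (_ * _)%E; [exact: lebesgue_measure_ball|exact: IH].
apply/seteqP; split => -[t v] /=.
  move=> tv; split; first by have := tv ord0; rewrite mxE unlift_none.
  by move=> i; have := tv (lift ord0 i); rewrite !mxE liftK.
move=> [ta va] i; rewrite !mxE; case: unliftP => [j ->|->//].
by have := va j; rewrite mxE.
Qed.

Lemma lebesgue_rV_cube_gt0 n (a : 'rV[R]_n) e : 0 < e ->
  (0 < lebesgue_rV n (cube a e))%E.
Proof. by move=> e0; rewrite lebesgue_rV_cube ?ltW// lte_fin exprn_gt0//
  mulrn_wgt0. Qed.

End cubes.

Section uniform_sphere_pos.
Context {R : realType} {d : nat} (d_gt0 : (0 < d)%N).

Lemma continuous_enorm : continuous (@enorm R d).
Proof.
move=> x; apply: (continuous_comp (f := fun x : 'rV[R]_d => dot x x));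
  last exact: sqrt_continuous.
have : continuous (fun x : 'rV[R]_d => dot x x); last exact.
apply: (@continuous_big R _ +%R); first exact: add_continuous.
move=> i _ {}x.
exact: (@continuousM _ _ (fun x : 'rV[R]_d => x 0 i) (fun x : 'rV[R]_d => x 0 i) x
  (@coord_continuous _ _ _ _ _ x) (@coord_continuous _ _ _ _ _ x)).
Qed.

Lemma continuous_direction_coord i (y : 'rV[R]_d) : y != 0 ->
  {for y, continuous (fun x : 'rV[R]_d => direction x 0 i)}.
Proof.
move=> y0; rewrite (_ : (fun x => _) = (fun x : 'rV[R]_d => (enorm x)^-1 * x 0 i));
  last first.
  by apply/funext => x; rewrite mxE.
apply: (@continuousM _ _ (fun x : 'rV[R]_d => (enorm x)^-1) (fun x : 'rV[R]_d =>
  x 0 i) y).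
  apply: (@continuousV _ _ (@enorm R d) y); first by rewrite enorm_eq0.
  exact: continuous_enorm.
exact: coord_continuous.
Qed.

(** The point e/2 lies inside the ball, away from 0, and has direction [e]. By continuity a cube
    around it has all its directions in the box, and a cube has positive volume. *)
Lemma uniform_sphere_box_gt0 (c : code d) (e : 'rV[R]_d) : enorm e = 1 ->
  box2 c e -> (0 < uniform_sphere (box2 c : set 'rV[R]_d))%E.
Proof.
move=> e1 ce; have e0 : e != 0 by rewrite -enorm_gt0 e1.
pose y := 2^-1 *: e.
have y0 : y != 0 by rewrite scaler_eq0 negb_or e0 andbT invr_eq0.
have ye : direction y = e by rewrite directionZ// /direction e1 invr1 scale1r.
have y1 : enorm y < 1 by rewrite enormZ e1 mulr1 ger0_norm// invf_lt1// ltr1n.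
have y1' : 0 < enorm y by rewrite enorm_gt0.
have : \forall x \near y, x != 0 /\ enorm x <= 1 /\ forall i,
  `|direction x 0 i - ratr (c.1.2 0 i)| < @box_radius R d c.
  near=> x; split; last split.
  - rewrite -enorm_gt0; near: x.
    by apply: (cvgr_gt (enorm y)); [exact: continuous_enorm|].
  - by apply: ltW; near: x; apply: (cvgr_lt (enorm y)); [exact: continuous_enorm|].
  - near: x; apply: filter_forall => i.
    have := ce i; rewrite -ye; apply: cvgr_lt; apply: cvg_norm.
    apply: cvgB; last exact: cvg_cst.
    exact: continuous_direction_coord.
move=> /nbhs_ballP[del /= del0 sub].
rewrite /uniform_sphere lte_fin divr_gt0 ?ball_volume_gt0//.
rewrite fine_gt0// spherical_cone_fin ?andbT; last exact: measurable_box2.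
apply: lt_le_trans (lebesgue_rV_cube_gt0 y del0) _; apply: le_measure; rewrite ?inE.
- exact: measurable_cube.
- by apply: measurable_spherical_cone; exact: measurable_box2.
- move=> x xy; have [] : x != 0 /\ enorm x <= 1 /\ forall i,
    `|direction x 0 i - ratr (c.1.2 0 i)| < @box_radius R d c.
    by apply: sub; split => // i j; rewrite (ord1 i); exact: xy.
  by move=> x0 [x1 xc]; split.
Unshelve. all: by end_near. Qed.

End uniform_sphere_pos.

(** * Empty regions and almost sure events *)

Section poisson_void.
Local Open Scope ereal_scope.
Context {R : realType} {dO} {Omega : measurableType dO} (P : probability Omega R).

Lemma probability_eq_ae (X Y : set Omega) : measurable X -> measurable Y ->
  {ae P, forall w, X w <-> Y w} -> P X = P Y.
Proof.
move=> mX mY [N [mN PN XYN]].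
have PCN : P (~` N) = 1 by rewrite probability_setC// PN sube0.
have mCN := measurableC mN.
rewrite -(probability_setI1 mCN mX PCN) -(probability_setI1 mCN mY PCN).
congr (P _); apply/seteqP; split => w [wXY nN]; split => //;
(have XY : X w <-> Y w by apply: contrapT => h; apply: nN; exact: XYN); exact/XY.
Qed.

Lemma ae_prob1 (X : set Omega) : measurable X -> P X = 1 ->
  {ae P, forall w, X w}.
Proof.
move=> mX PX; exists (~` X); split => //; first exact: measurableC.
by have := probability_setC P mX; rewrite PX subee.
Qed.

Lemma poisson_void {dT} {T : measurableType dT} (nu : set T -> \bar R)
    (eta : Omega -> {measure set T -> \bar R}) (B : set T) :
  is_poisson_process P nu eta -> measurable B -> 0 <= nu B -> nu B < +oo ->
  P [set w | eta w B = 0] = (expR (- fine (nu B)))%:E.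
Proof.
move=> pois mB nu0 nuoo.
have := poisson_process_law pois 0%N mB nuoo; rewrite mulr0n => ->.
rewrite /poisson_prob; case: ltP => nuB.
  by rewrite esum_set1 ?lee_fin ?poisson_pmf_ge0// /poisson_pmf nuB expr0 divr1 mul1r.
have -> : fine (nu B) = 0%R by apply/eqP; rewrite eq_le nuB fine_ge0.
by rewrite oppr0 expR0 diracE mem_set.
Qed.

(** The first [n] marks all miss [B] with probability (1 - s)^n, which tends to 0. *)
Lemma iid_hits_ae {dT} {T : measurableType dT} (u : nat -> Omega -> T) (B :
  set T) (s : R) :
  (forall n, measurable_fun setT (u n)) -> mutually_independent P u ->
  measurable B -> (forall n, P (u n @^-1` B) = s%:E) -> (0 < s)%R ->
  {ae P, forall w, exists n, B (u n w)}.
Proof.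
move=> mu ind mB us s0.
have mpre n : measurable (u n @^-1` B) by rewrite -[X in measurable X]setTI; exact: mu.
have s1 : (s <= 1)%R by rewrite -lee_fin -(us 0%N) probability_le1.
exists (\bigcap_n ~` (u n @^-1` B)); split.
- by apply: bigcapT_measurable => n; exact: measurableC.
- have bound n : P (\bigcap_n ~` (u n @^-1` B)) <= ((1 - s) ^+ n)%:E.
    apply: (@le_trans _ _ (P (\bigcap_(i in [set` iota 0 n]) u i @^-1` (~` B)))).
      apply: le_measure; rewrite ?inE.
      + by apply: bigcapT_measurable => i; exact: measurableC.
      + by apply: bigcap_measurableType => i _; rewrite -preimage_setC;
          exact: measurableC.
      + by move=> w wB i _; exact: wB.
    rewrite (ind _ (fun _ => ~` B)) ?iota_uniq//; last by move=> i; exact: measurableC.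
    under eq_bigr do rewrite -preimage_setC probability_setC// us -EFinB.
    by rewrite prodEFin big_const_seq count_predT size_iota iter_mulr_1.
  apply/eqP; rewrite eq_le measure_ge0 andbT.
  have : ((1 - s) ^+ n)%:E @[n --> \oo] --> 0.
    apply/fine_cvgP; split; first by near=> n.
    by apply: cvg_expr; rewrite ger0_norm ?subr_ge0// ltrBlDr ltrDl.
  by move/cvge_to_ge; apply; near=> n; exact: bound.
- by move=> w /= /forallNP wB n _; exact: wB.
Unshelve. all: by end_near. Qed.

End poisson_void.

(** * Void probabilities *)

Section labels.
Context {R : realType} {d : nat}.
Variables (l : seq (code d)) (W : set (measurableTypeR R)).
Hypothesis mW : measurable W.

Local Notation n := (size l).
Local Notation cell i := (nth ((0%R, 0%R, 0%N) : code d) l i).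

(* The boxes [box1 c `*` box2 c], [c] in [l], whose first factor contains [t]. *)
Let pattern (t : R) : {set 'I_n} := finset (fun i : 'I_n => `[< box1 (cell i) t >]).

(** Radii of [W] share a label when they lie in the first factors of the same boxes, hence forbid
    the same directions. [enum_rank] turns the set of box indices into an ordinal, as [marks_avoid]
    expects. *)
Definition label (t : measurableTypeR R) : option 'I_#|{set 'I_n}| :=
  if `[< W t >] then Some (enum_rank (pattern t)) else None.

Definition label_marks (j : 'I_#|{set 'I_n}|) : set 'rV[R]_d :=
  \bigcup_(i in [set i : 'I_n | i \in (enum_val j : {set 'I_n})]) box2 (cell i).

Lemma measurable_label o : measurable (label @^-1` [set o]).
Proof.
case: o => [j|]; last first.
  rewrite (_ : _ @^-1` _ = ~` W); first exact: measurableC.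
  by apply/seteqP; split => t; rewrite /= /label; case: asboolP.
rewrite (_ : _ @^-1` _ = W `&` \bigcap_(i in [set: 'I_n])
    (if i \in (enum_val j : {set 'I_n}) then box1 (cell i) else ~` box1 (cell i))).
  apply: measurableI => //; apply: fin_bigcap_measurable => // i _.
  case: ifP => _; last apply: measurableC; exact: measurable_box1.
apply/seteqP; split => t; rewrite /= /label; case: asboolP => // Wt.
- move=> -[<-]; split => // i _; rewrite enum_rankK inE.
  by case: ifP => [/asboolP//|/asboolP].
- move=> [_ tj]; congr Some; apply: (canLR (@enum_valK _)); apply/setP => i.
  by rewrite inE; have := tj i I; case: ifP => _ h; apply/asboolP.
- by move=> [].
Qed.

Lemma measurable_label_marks j : measurable (label_marks j).
Proof. by apply: fin_bigcup_measurable => // i _; exact: measurable_box2. Qed.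

Lemma label_sub j : label @^-1` [set Some j] `<=` W.
Proof. by move=> t; rewrite /= /label; case: asboolP. Qed.

(** Boxes are products: for a fixed radius, hitting one of them is a condition on the direction that
    depends on the radius only through its pattern. *)
Lemma label_missP (S : set (R * 'rV[R]_d)) :
  (forall c, c \in l -> ~ hits (S `&` [set p | W p.1]) c) <->
  (forall p, S p -> forall j, label p.1 = Some j -> ~ label_marks j p.2).
Proof.
split => [miss p Sp j|avoid c cl [p [[Sp Wp] [/= p1 p2]]]].
  rewrite /label; case: asboolP => // Wp [<-] [i /=]; rewrite enum_rankK inE =>
    /asboolP pi1 pi2.
  by apply: (miss (cell i)); [exact: mem_nth|exists p].
have il : (index c l < n)%N by rewrite index_mem.
apply: (avoid p Sp (enum_rank (pattern p.1))).
  by rewrite /label; case: asboolP.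
exists (Ordinal il) => /=; last by rewrite nth_index.
by rewrite enum_rankK inE /= nth_index//; apply/asboolP.
Qed.

End labels.

Section polar_union.
Local Open Scope ereal_scope.
Context {R : realType} {d : nat} (d_gt0 : (0 < d)%N) (lambda beta : R).
Hypotheses (lambda_gt0 : (0 < lambda)%R) (beta_gt0 : (0 < beta)%R)
  (beta_gt : (d%:R / 2 < beta)%R).

Local Notation alpha := (lambda / (ctilde d beta * omega d))%R.

Let f (x : 'rV[R]_d) := (alpha * ctilde d beta * (enorm x ^+ 2 - 1) `^ (- beta))%R.

Let f_ge0 x : (0 <= f x)%R.
Proof.
have c0 := ctilde_gt0 beta_gt0 beta_gt.
rewrite mulr_ge0 ?powR_ge0// mulr_ge0 ?(ltW c0)// divr_ge0 ?(ltW lambda_gt0)//.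
by rewrite mulr_ge0 ?(ltW c0)// omegaE// mulr_ge0// ball_volume_ge0.
Qed.

Let mf : measurable_fun setT f.
Proof.
apply: measurable_funM => //.
apply: (@measurableT_comp _ _ _ _ _ _ (fun x => x `^ (- beta))%R) => //.
by apply: measurable_funB => //; apply: measurable_funX; exact: measurable_enorm.
Qed.

Lemma beta_star_intensity_ge0 B : 0 <= beta_star_intensity alpha beta (B :
  set 'rV[R]_d).
Proof. by apply: integral_ge0 => x _; rewrite lee_fin; exact: f_ge0. Qed.

(** The intensity is a bare set function; additivity comes from recognising it as [density_measure]
    off the ball. *)
Lemma beta_star_intensity_bigU (I : finType) (B : I -> set 'rV[R]_d) :
  (forall i, measurable (B i)) -> (forall i j, i != j -> B i `&` B j = set0) ->
  beta_star_intensity alpha beta (\big[setU/set0]_i B i) =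
  \sum_i beta_star_intensity alpha beta (B i).
Proof.
move=> mB tB.
rewrite (_ : beta_star_intensity alpha beta =
  fun B => density_measure (lebesgue_rV d) f_ge0 mf (B `\` closed_ball1))//.
rewrite setDE big_distrl/= measure_bigsetU_seq ?index_enum_uniq//.
- move=> i; apply: measurableD => //; exact: measurable_closed_ball1.
- move=> i j /tB ij; rewrite -subset0 => x [[Bi _] [Bj _]].
  by suff : (B i `&` B j) x; [rewrite ij|split].
Qed.

End polar_union.

Section missing.
Local Open Scope ereal_scope.
Context {R : realType} {d : nat} {dO} {Omega : measurableType dO}.
Variables (P : probability Omega R) (S : Omega -> set (R * 'rV[R]_d)).
Implicit Types (l : seq (code d)) (V : set (measurableTypeR R)).

Definition missing l V : set Omega :=
  [set w | forall c, c \in l -> ~ hits (S w `&` [set p | V p.1]) c].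

Hypothesis mS : forall V c, measurable V ->
  measurable [set w | hits (S w `&` [set p | V p.1]) c].

Lemma measurable_missing l V : measurable V -> measurable (missing l V).
Proof.
move=> mV; rewrite (_ : missing l V =
    \bigcap_(c in [set` l]) ~` [set w | hits (S w `&` [set p | V p.1]) c]).
  by apply: fin_bigcap_measurable => // c _; apply: measurableC; exact: mS.
by apply/seteqP; split => w wl c cl; exact: wl.
Qed.

(** Admitting more radii makes missing harder, so the events decrease and continuity from above
    applies. *)
Lemma missing_cvg l (V : (set (measurableTypeR R))^nat) :
  (forall m, measurable (V m)) -> nondecreasing_seq V ->
  P (missing l (V m)) @[m --> \oo] --> P (missing l (\bigcup_m V m)).
Proof.
move=> mV ndV.
have -> : missing l (\bigcup_m V m) = \bigcap_m missing l (V m).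
  apply/seteqP; split => w wl.
    by move=> m _ c cl [p [[Sp Vp] pc]]; apply: (wl c cl); exists p; split => //;
      split => //; exists m.
  by move=> c cl [p [[Sp [m _ Vp]] pc]]; apply: (wl m I c cl); exists p.
have mM m : measurable (missing l (V m)) by exact: measurable_missing.
apply: nonincreasing_cvg_mu => //.
- by rewrite -ge0_fin_numE// fin_num_measure.
- exact: bigcapT_measurable.
- move=> a b ab; have /subsetPset Vab := ndV _ _ ab.
  apply/subsetPset => w wl c cl [p [[Sp Vp] pc]].
  by apply: (wl c cl); exists p; split => //; split => //; exact: Vab.
Qed.

End missing.

Section void_probabilities.
Local Open Scope ereal_scope.
Context {R : realType} {d : nat} (d_gt0 : (0 < d)%N) (lambda beta : R).
Hypotheses (lambda_gt0 : (0 < lambda)%R) (beta_gt0 : (0 < beta)%R)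
  (beta_gt : (d%:R / 2 < beta)%R).
Context {d1} {Omega1 : measurableType d1} (P1 : probability Omega1 R)
  (r : nat -> {RV P1 >-> R}) (u : nat -> {RV P1 >-> 'rV[R]_d}).
Hypothesis ru : zero_cell_sequences lambda beta r u.
Context {d2} {Omega2 : measurableType d2} (P2 : probability Omega2 R)
  (eta : Omega2 -> {measure set 'rV[R]_d -> \bar R}).
Hypothesis eta_poisson : is_poisson_process P2
     (beta_star_intensity (lambda / (ctilde d beta * omega d)) beta) eta.

Local Notation nu := (zero_cell_intensity d lambda beta).
Local Notation mu := (beta_star_intensity (lambda / (ctilde d beta * omega d)) beta).

Definition zero_cell_config w :=
  zero_cell_constraints (fun n => r n w) (fun n => u n w).

Definition beta_star_config w := dual_constraints (atoms (eta w)).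

Local Notation S1 := zero_cell_config.
Local Notation S2 := beta_star_config.

Let mr n : measurable_fun setT (r n : Omega1 -> R).
Proof. exact: measurable_funPT. Qed.

Let mu_ n : measurable_fun setT (u n : Omega1 -> 'rV[R]_d).
Proof. exact: measurable_funPT. Qed.

Lemma zero_cell_marks_law n (B : set 'rV[R]_d) : measurable B ->
  P1 (u n @^-1` B) = uniform_sphere B.
Proof. by move=> mB; rewrite -(zero_cell_uniform ru n mB). Qed.

Let density (t : R) : R :=
  (lambda * (t `^ (2 * beta - d%:R - 1) / (1 - t ^+ 2) `^ beta))%R.

Let density_ge0 t : (0 <= density t)%R.
Proof. by rewrite mulr_ge0 ?divr_ge0 ?powR_ge0// ltW. Qed.

Let mdensity : measurable_fun setT density.
Proof.
apply: measurable_funM => //; apply: measurable_funM => //.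
rewrite (_ : (fun x : R => _) = (fun x : R => (1 - x ^+ 2) `^ (- beta))%R); last first.
  by apply/funext => x; rewrite powRN.
apply: (@measurableT_comp _ _ _ _ _ _ (fun x => x `^ (- beta))%R) => //.
by apply: measurable_funB => //; exact: measurable_funX.
Qed.

Let nu_ge0 B : 0 <= nu B.
Proof. by apply: integral_ge0 => x _; rewrite lee_fin; exact: density_ge0. Qed.

(* Level sets of the density exhaust ]0, 1[ by sets of finite intensity. *)
Let window (m : nat) : set (measurableTypeR R) :=
  `]0%R, 1%R[%classic `&` [set t | (density t <= m%:R)%R].

Let mwindow m : measurable (window m).
Proof.
apply: measurableI; first exact: measurable_itv.
rewrite (_ : [set t | _] = density @^-1` `]-oo, m%:R%R]).
  by rewrite -[X in measurable X]setTI; apply: mdensity => //; exact: measurable_itv.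
by apply/seteqP; split => t; rewrite /= in_itv.
Qed.

Let window_nd : nondecreasing_seq window.
Proof.
move=> m n mn; apply/subsetPset; apply: setIS => t /= /le_trans; apply.
by rewrite ler_nat.
Qed.

Let bigcup_window : \bigcup_m window m = `]0%R, 1%R[%classic.
Proof.
apply/seteqP; split => [t [m _ []]//|t t01]; exists (Num.bound (density t)) => //.
by split => //=; rewrite ltW// archi_boundP.
Qed.

Let nu_window m B : measurable B -> B `<=` window m -> nu B < +oo.
Proof.
move=> mB BW; apply: (@le_lt_trans _ _ (\int[lebesgue_measure]_(t in B `&` `]0%R,
  1%R[) (m%:R)%:E)).
  apply: ge0_le_integral => //.
  - by apply: measurableI => //; exact: measurable_itv.
  - by move=> t _; rewrite lee_fin; exact: density_ge0.
  - by apply: measurable_funTS; apply/measurable_EFinP; exact: mdensity.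
  - by move=> t [/BW[_ +] _]; rewrite lee_fin.
rewrite integral_cst; last by apply: measurableI => //; exact: measurable_itv.
apply: (@le_lt_trans _ _ (m%:R%:E * lebesgue_measure (`]0%R, 1%R[%classic : set R))).
  rewrite lee_wpmul2l ?lee_fin//; apply: le_measure; rewrite ?inE.
  - by apply: measurableI => //; exact: measurable_itv.
  - exact: measurable_itv.
  - exact: subIsetr.
by rewrite lebesgue_measure_itv/= lte_fin ltr01 -EFinB -EFinM ltry.
Qed.

Lemma measurable_hits_zero_cell (V : set (measurableTypeR R)) c : measurable V ->
  measurable [set w | hits (S1 w `&` [set p | V p.1]) c].
Proof.
move=> mV; rewrite (_ : [set w | _] =
    \bigcup_n ((r n @^-1` (V `&` box1 c)) `&` (u n @^-1` box2 c))).
  apply: bigcupT_measurable => n; apply: measurableI.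
    rewrite -[X in measurable X]setTI; apply: mr => //.
    by apply: measurableI => //; exact: measurable_box1.
  by rewrite -[X in measurable X]setTI; apply: mu_ => //; exact: measurable_box2.
apply/seteqP; split => w.
  by move=> [_ [[[n _ <-] /= Vr] [rc uc]]]; exists n.
by move=> [n _ [[Vr rc] uc]]; exists (r n w, u n w); split => //; split => //; exists n.
Qed.

(** The preimage of I x A under the map y -> (1/|y|, y/|y|) behind [dual_constraints]. *)
Let polar (A : set 'rV[R]_d) (I : set (measurableTypeR R)) : set 'rV[R]_d :=
  cone A `&` (fun y => (enorm y)^-1)%R @^-1` I.

Let measurable_polar A I : measurable A -> measurable I -> measurable (polar A I).
Proof.
move=> mA mI; apply: measurableI; first exact: measurable_cone.
by rewrite -[X in measurable X]setTI; exact: measurable_enormV.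
Qed.

Let eta_eq0 w B : measurable B ->
  eta w B = 0 <-> forall y, atoms (eta w) y -> ~ B y.
Proof.
move=> mB; apply: counting_measure_eq0 => //.
- exact: poisson_process_counting eta_poisson w.
- exact: measurable_rV1.
Qed.

Let meta B : measurable B -> measurable [set w | eta w B = 0].
Proof.
move=> mB; have := poisson_process_measurable eta_poisson mB.
by move=> /(_ measurableT _ (emeasurable_set1 0)); rewrite setTI.
Qed.

(** A box is hit exactly when [eta] charges its preimage under the polar map. *)
Lemma measurable_hits_beta_star (V : set (measurableTypeR R)) c : measurable V ->
  measurable [set w | hits (S2 w `&` [set p | V p.1]) c].
Proof.
move=> mV; pose B := polar (box2 c) (V `&` box1 c).
have mB : measurable B.
  apply: measurable_polar; first exact: measurable_box2.
  by apply: measurableI => //; exact: measurable_box1.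
rewrite (_ : [set w | _] = ~` [set w | eta w B = 0]); first exact/measurableC/meta.
apply/seteqP; split => w.
  move=> [_ [[[y [Yy /= y0] <-] /= Vy] [yc1 yc2]]] /(eta_eq0 _ mB)/(_ y Yy); apply.
  by split.
move=> /= eB; apply: contrapT => nh; apply: eB; apply/(eta_eq0 _ mB) =>
  y Yy [[y0 yc2] [Vy yc1]].
by apply: nh; exists ((enorm y)^-1%R, direction y); split => //; split => //; exists y.
Qed.

(** The left side is a void probability of marked points, the right side one of [eta] on the polar
    preimage [U] of the same forbidden pairs. The exponents agree label by label. *)
Let window_void l m : P1 (missing S1 l (window m)) = P2 (missing S2 l (window m)).
Proof.
pose lab := label l (window m); pose A := @label_marks R d l.
have mlab o : measurable (lab @^-1` [set o]) by exact: measurable_label.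
have mA j : measurable (A j) by exact: measurable_label_marks.
have labW j : lab @^-1` [set Some j] `<=` window m by exact: label_sub.
have nuoo j : nu (lab @^-1` [set Some j]) < +oo by exact: nu_window (labW j).
have -> : missing S1 l (window m) = marks_avoid (fun n => r n :
  Omega1 -> R) (fun n => u n : Omega1 -> 'rV[R]_d) lab A.
  apply/seteqP; split => w.
    by move/label_missP => avoid n j rj; apply: (avoid (r n w, u n w)) rj; exists n.
  by move=> avoid; apply/label_missP => _ [n _ <-] j /=; exact: avoid.
rewrite (marks_avoid_void (P := P1) (nu := nu) mr mu_)//; last 4 first.
- by move=> n B mB; rewrite !zero_cell_marks_law.
- exact: zero_cell_iid ru.
- exact: zero_cell_independent ru.
- exact: zero_cell_poisson ru.
pose B j := polar (A j) (lab @^-1` [set Some j]).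
have mB j : measurable (B j) by exact: measurable_polar.
(* The pieces are disjoint, since 1/|y| carries a single label; thus the intensity of [U] is a sum
   over labels. *)
pose U := \big[setU/set0]_j B j.
have mU : measurable U by exact: bigsetU_measurable.
have UE y : U y <-> exists j, B j y.
  rewrite /U -bigcup_seq; split => [[j _ Bj]|[j Bj]]; exists j => //=.
  exact: mem_index_enum.
have -> : missing S2 l (window m) = [set w | eta w U = 0].
  apply/seteqP; split => w.
    move/label_missP => avoid; apply/(eta_eq0 _ mU) => y Yy /UE[j [[y0 Aj] yj]].
    by apply: (avoid ((enorm y)^-1%R, direction y) _ j yj Aj); exists y.
  move/(eta_eq0 _ mU) => avoid; apply/label_missP => _ [y [Yy y0] <-] j /= yj Aj.
  by apply: (avoid y Yy); apply/UE; exists j.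
have muU : mu U = (\sum_j fine (nu (lab @^-1` [set Some j])) * fine (P1 (u 0%N
  @^-1` A j)))%R%:E.
  rewrite beta_star_intensity_bigU//; last first.
    move=> i j /eqP ij; rewrite -subset0 => y [[_ yi] [_ yj]]; apply: ij.
    by move: yi yj => /= -> [].
  rewrite -sumEFin; apply: eq_bigr => j _.
  rewrite beta_star_intensity_polar//; last first.
    by apply: subset_trans (labW j) _ => t [].
  rewrite zero_cell_marks_law// muleC EFinM; congr (_ * _).
  by rewrite fineK// ge0_fin_numE.
rewrite (poisson_void eta_poisson mU) ?muU ?ltry//.
by rewrite -muU; exact: beta_star_intensity_ge0.
Qed.

Let missing_unit_interval l :
  P1 (missing S1 l `]0%R, 1%R[%classic) = P2 (missing S2 l `]0%R, 1%R[%classic).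
Proof.
rewrite -bigcup_window.
have c1 := missing_cvg (P := P1) (l := l) measurable_hits_zero_cell mwindow window_nd.
have c2 := missing_cvg (P := P2) (l := l) measurable_hits_beta_star mwindow window_nd.
apply: (cvg_unique _ c1) => //.
rewrite (_ : (fun m => _) = (fun m => P2 (missing S2 l (window m)))) //.
by apply/funext => m; exact: window_void.
Qed.

Lemma zero_cell_radii_ae : {ae P1, forall w, forall n, (0 < r n w < 1)%R}.
Proof.
pose B : set (measurableTypeR R) := ~` `]0%R, 1%R[%classic.
have mB : measurable B by apply: measurableC; exact: measurable_itv.
have nuB : nu B = 0.
  by rewrite /zero_cell_intensity setICl integral_set0.
have PB := poisson_void (zero_cell_poisson ru) mB (nu_ge0 B).
have {}PB : P1 [set w | point_count (fun n => r n w) B = 0 :> \bar R] = 1.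
  by rewrite PB nuB ?ltry//= oppr0 expR0.
have mPB : measurable [set w | point_count (fun n => r n w) B = 0 :> \bar R].
  have := poisson_process_measurable (zero_cell_poisson ru) mB.
  by move=> /(_ measurableT _ (emeasurable_set1 0)); rewrite setTI.
apply: filterS (ae_prob1 mPB PB) => w /point_count0 wB n.
by have /contrapT := wB n; rewrite /= in_itv.
Qed.

(** The intensity vanishes on the punctured ball. Puncturing is harmless: the origin contributes no
    pair to [dual_constraints]. *)
Lemma beta_star_radii_ae : {ae P2, forall w, forall p, S2 w p -> (0 < p.1 < 1)%R}.
Proof.
pose B := spherical_cone [set: 'rV[R]_d].
have mB : measurable B by exact: measurable_spherical_cone.
have muB : mu B = 0.
  rewrite /beta_star_intensity (_ : B `\` _ = set0) ?integral_set0//.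
  by rewrite /B spherical_coneE -subset0 => x [[_ xb] /(_ xb)].
have PB : P2 [set w | eta w B = 0] = 1.
  by rewrite (poisson_void eta_poisson mB) muB ?ltry//= oppr0 expR0.
apply: filterS (ae_prob1 (meta mB) PB) => w /(eta_eq0 _ mB) wB _ [y [Yy /= y0] <-] /=.
rewrite invr_gt0 enorm_gt0 y0/= invf_lt1 ?enorm_gt0// ltNge; apply/negP => y1.
by apply: (wB y Yy); split.
Qed.

(** On both sides the first components lie in ]0, 1[ almost surely, so restricting to that interval
    changes no probability. *)
Lemma missing_same_probability l : P1 (missing S1 l setT) = P2 (missing S2 l setT).
Proof.
transitivity (P1 (missing S1 l `]0%R, 1%R[%classic)).
  apply: probability_eq_ae.
  - by apply: measurable_missing => //; exact: measurable_hits_zero_cell.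
  - by apply: measurable_missing; [exact: measurable_hits_zero_cell|exact:
      measurable_itv].
  apply: filterS zero_cell_radii_ae => w w01; split => miss c cl [p [[Sp Vp] pc]];
  apply: (miss c cl); exists p; split => //; split => //.
  by move: Sp => [n _ <-] /=; rewrite in_itv/=; exact: w01.
rewrite missing_unit_interval; apply: probability_eq_ae.
- by apply: measurable_missing; [exact: measurable_hits_beta_star|exact:
    measurable_itv].
- by apply: measurable_missing => //; exact: measurable_hits_beta_star.
apply: filterS beta_star_radii_ae => w w01; split => miss c cl [p [[Sp Vp] pc]];
apply: (miss c cl); exists p; split => //; split => //.
by rewrite /= in_itv/=; exact: w01.
Qed.

End void_probabilities.

(** * Equality of the laws *)

Section bounded_cell.
Local Open Scope ereal_scope.
Context {R : realType} {d : nat} (d_gt0 : (0 < d)%N) (lambda beta : R).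
Hypothesis lambda_gt0 : (0 < lambda)%R.
Context {d1} {Omega1 : measurableType d1} (P1 : probability Omega1 R)
  (r : nat -> {RV P1 >-> R}) (u : nat -> {RV P1 >-> 'rV[R]_d}).
Hypothesis ru : zero_cell_sequences lambda beta r u.

(** The exceptional null set depends on the box; countability of [code], through [unpickle], gives a
    common one. *)
Lemma marks_hit_boxes_ae : {ae P1, forall w, forall c : code d,
  0 < uniform_sphere (box2 c : set 'rV[R]_d) -> exists n, box2 c (u n w)}.
Proof.
have H c : {ae P1, forall w, 0 < uniform_sphere (box2 c : set 'rV[R]_d) ->
    exists n, box2 c (u n w)}.
  have [c0|c0] := boolP (0 < uniform_sphere (box2 c : set 'rV[R]_d)); last first.
    by apply: nearW.
  have mc : measurable (box2 c : set 'rV[R]_d) by exact: measurable_box2.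
  have us n : P1 (u n @^-1` box2 c) = (fine (uniform_sphere (box2 c :
    set 'rV[R]_d)))%:E.
    by rewrite (zero_cell_marks_law ru).
  have mu n : measurable_fun setT (u n : Omega1 -> 'rV[R]_d) by exact: measurable_funPT.
  by apply: filterS (iid_hits_ae mu (zero_cell_iid ru) mc us c0) => w cw _.
have {}H : {ae P1, forall w, forall n, if (unpickle n : option (code d)) is Some c
    then 0 < uniform_sphere (box2 c : set 'rV[R]_d) -> exists n,
      box2 c (u n w) else True}.
  by apply: ae_foralln => n; case: (unpickle n) => [c|]; [exact: H|exact: nearW].
by apply: filterS H => w H c; have := H (pickle c); rewrite pickleK.
Qed.

(** If |x| > 1, then [x] violates the pair (1, x/|x|), and also every pair in some rational box
    around it. The directions of that box have positive uniform mass, so some u_n is among them. *)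
Lemma zero_cell_config_bounded_ae : {ae P1, forall w,
  constraint_set (zero_cell_config r u w) `<=` @closed_ball1 R d}.
Proof.
have H := zero_cell_radii_ae lambda_gt0 ru; apply: filterS2 H marks_hit_boxes_ae =>
  w r01 hit x xS.
rewrite /closed_ball1/= leNgt; apply/negP => x1.
have x0 : (x != 0)%R by rewrite -enorm_gt0 (lt_trans _ x1).
have [] := @violating_box R d x (1%R, direction x).
  by rewrite /= dot_direction -sqr_enorm expr2 mulKf ?enorm_eq0.
move=> c [/= c1 c2] cx.
have [n un] := hit c (uniform_sphere_box_gt0 d_gt0 (enorm_direction x0) c2).
(* The radius r_n need not lie in the box, so the pair (1, u_n) is used: 1 < <x, u_n> contradicts
   <x, u_n> <= r_n < 1. *)
have /= := cx (1%R, u n w) (conj c1 un).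
have /andP[_ rn] := r01 n.
have /= := xS (r n w, u n w); rewrite leNgt => /(_ _)/negP.
by move=> h; apply/negP; rewrite -leNgt; apply: (le_trans _ (ltW rn));
  rewrite leNgt; apply/negP; apply: h; exists n.
Qed.

End bounded_cell.

Theorem theorem3p1 (R : realType) (d : nat) (lambda beta : R)
  (d_gt0 : (0 < d)%N) (lambda_gt0 : 0 < lambda)
  (beta_gt : Num.max (d%:R / 2) 1 < beta)
  (d1 : measure_display) (Omega1 : measurableType d1)
  (P1 : probability Omega1 R)
  (r : nat -> {RV P1 >-> R})
  (u : nat -> {RV P1 >-> 'rV[R]_d})
  (ru : zero_cell_sequences lambda beta r u)
  (d2 : measure_display) (Omega2 : measurableType d2)
  (P2 : probability Omega2 R)
  (eta : Omega2 -> {measure set 'rV[R]_d -> \bar R})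
  (eta_poisson : is_poisson_process P2
     (beta_star_intensity (lambda / (ctilde d beta * omega d)) beta) eta) :
  same_distribution P1 P2
    (fun w => zero_cell (fun n => r n w) (fun n => u n w))
    (fun w => convex_dual (beta_star_set (eta w))).
Proof.
move: beta_gt; rewrite gt_max => /andP[beta_gt_half beta_gt1].
have beta_gt0 : 0 < beta by exact: lt_trans beta_gt1.
pose S1 := zero_cell_config r u; pose S2 := beta_star_config eta.
have -> : (fun w => zero_cell (fun n => r n w) (fun n => u n w)) =
    (fun w => constraint_set (S1 w) `&` @closed_ball1 R d).
  by apply/funext => w; rewrite zero_cellE.
(* Intersecting with [setT] gives both random sets the shape required by
   [hits_sigma_constraint_set]. *)
have -> : (fun w => convex_dual (beta_star_set (eta w))) =
    (fun w => constraint_set (S2 w) `&` setT).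
  by apply/funext => w; rewrite setIT /beta_star_set convex_dual_hullE.
have stripT (S : set (R * 'rV[R]_d)) : S `&` [set p | setT p.1] = S.
  by apply/seteqP; split => p; [case|].
have mS1 c : measurable [set w | hits (S1 w) c].
  have := measurable_hits_zero_cell r u c measurableT.
  by under eq_set do rewrite stripT.
have mS2 c : measurable [set w | hits (S2 w) c].
  have := measurable_hits_beta_star eta_poisson c measurableT.
  by under eq_set do rewrite stripT.
have same : forall D, <<s hits_sets >> D -> P1 (S1 @^-1` D) = P2 (S2 @^-1` D).
  apply: hits_sigma_same_probability => l M.
  have M1 : S1 @^-1` M = missing S1 l setT.
    by rewrite /missing; under eq_set do under eq_forall do rewrite stripT.
  have M2 : S2 @^-1` M = missing S2 l setT.
    by rewrite /missing; under eq_set do under eq_forall do rewrite stripT.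
  rewrite M1 M2; split.
  - by apply: measurable_missing => //; exact: measurable_hits_zero_cell.
  - by apply: measurable_missing => //; exact: measurable_hits_beta_star eta_poisson.
  - exact: (missing_same_probability d_gt0 lambda_gt0 beta_gt0 beta_gt_half ru
      eta_poisson).
have cball : closed (@closed_ball1 R d).
  by rewrite closed_ball1E; exact: closed_constraint_set.
have mX1 B A : closed B -> hitting_sigma_algebra A ->
    measurable ((fun w => constraint_set (S1 w) `&` B) @^-1` A).
  move=> cB hA; exact: (hits_sigma_measurable mS1 (hits_sigma_constraint_set cB hA)).
have mX2 A : hitting_sigma_algebra A ->
    measurable ((fun w => constraint_set (S2 w) `&` setT) @^-1` A).
  move=> hA; exact: (hits_sigma_measurable mS2 (hits_sigma_constraint_set closedT hA)).
split.
- split; last by move=> A; exact: mX1.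
  move=> w; rewrite closed_ball1E -constraint_setU; split.
    exact: closed_constraint_set.
  exact: convex_constraint_set.
- split; last exact: mX2.
  move=> w; rewrite setIT; split; first exact: closed_constraint_set.
  exact: convex_constraint_set.
move=> A hA.
(* The ball is first removed from the zero cell, almost surely without effect; both sides are then
   the same function of the configuration. *)
transitivity (P1 ((fun w => constraint_set (S1 w) `&` setT) @^-1` A)).
  apply: probability_eq_ae; [exact: mX1|exact: mX1 closedT hA|].
  apply: filterS (zero_cell_config_bounded_ae d_gt0 lambda_gt0 ru) => w wball /=.
  by rewrite setIT setIidl.
exact: (same _ (hits_sigma_constraint_set closedT hA)).
Qed.
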